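(* There is an algorithm that, given an $n$-vertex forest whose vertices are colored with two colors in a ratio $1:2$, computes a minimum-cost fair clustering in time $O(n^6)$.
   Context: All graphs are finite, simple and undirected. For a graph $G=(V,E)$ and a partition $\mathcal{P}$ of $V$, write $\mathcal{P}[u]$ for the set of $\mathcal{P}$ containing $u$. The cost is $$\mathrm{cost}(G,\mathcal{P})=\Big|\Big\{\{u,v\}\in\tbinom{V}{2}\setminus E : \mathcal{P}[u]=\mathcal{P}[v]\Big\}\Big|+\Big|\Big\{\{u,v\}\in E:\mathcal{P}[u]\neq\mathcal{P}[v]\Big\}\Big|.$$ A coloring is a map $c:V\to[k]$; let $V_i=c^{-1}(i)$. A set $S\subseteq V$ is fair if $|S\cap V_i|/|S|=|V_i|/|V|$ for every $i\in[k]$. A fair clustering is a partition of $V$ all of whose sets are fair; it is minimum-cost if no fair clustering has smaller cost. The colors are in ratio $c_1:\dots:c_k$ if there is $t\in\mathbb{N}_{>0}$ with $|V_i|=t\,c_i$ for all $i$. *)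

(* Defs.v *)
From mathcomp Require Import all_boot.
Set Implicit Arguments. Unset Strict Implicit. Unset Printing Implicit Defensive.

Definition simple_graph n (e : rel 'I_n) : Prop :=
  irreflexive e /\ symmetric e.

Definition forest n (e : rel 'I_n) : Prop :=
  ~ exists s : seq 'I_n, [&& uniq s, 3 <= size s & cycle e s].

(* two colors (false = color 1, true = color 2); V_b = color class *)
Definition color_class n (col : 'I_n -> bool) (b : bool) : {set 'I_n} :=
  [set v | col v == b].

Definition ratio_1_2 n (col : 'I_n -> bool) : Prop :=
  exists2 t, 0 < t & #|color_class col false| = t /\ #|color_class col true| = 2 * t.

(* S fair : |S ∩ V_i| / |S| = |V_i| / |V| for all i (cross-multiplied; only
   used for nonempty S) *)
Definition fair_set n (col : 'I_n -> bool) (S : {set 'I_n}) : Prop :=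
  forall b, #|S :&: color_class col b| * n = #|color_class col b| * #|S|.

(* A partition P of 'I_n is represented by a labeling p : 'I_n -> nat;
   P[u] = the set of vertices with the same label as u. Every partition
   arises this way. *)
Definition cluster n (p : 'I_n -> nat) (u : 'I_n) : {set 'I_n} :=
  [set v | p v == p u].

Definition fair_clustering n (col : 'I_n -> bool) (p : 'I_n -> nat) : Prop :=
  forall u, fair_set col (cluster p u).

Definition cost n (e : rel 'I_n) (p : 'I_n -> nat) : nat :=
  #|[set x : 'I_n * 'I_n | (x.1 < x.2) &&
       ((~~ e x.1 x.2 && (p x.1 == p x.2)) || (e x.1 x.2 && (p x.1 != p x.2)))]|.

Definition min_cost_fair_clustering n (e : rel 'I_n) (col : 'I_n -> bool)
    (p : 'I_n -> nat) : Prop :=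
  fair_clustering col p /\
  forall q : 'I_n -> nat, fair_clustering col q -> cost e p <= cost e q.

(* Values are naturals; every value computed must be < W (the word bound),
   otherwise the computation is stuck (no derivation). Each executed
   elementary command / test costs one step. *)

Inductive aexp : Type :=
  | ANum  of nat
  | AVar  of nat
  | AAdd  of aexp & aexp
  | ASub  of aexp & aexp          (* truncated subtraction *)
  | AMul  of aexp & aexp
  | ADiv  of aexp & aexp          (* x / 0 = 0 *)
  | AMod  of aexp & aexp          (* x mod 0 = x *)
  | ALt   of aexp & aexp
  | AEq   of aexp & aexp
  | ALoad of nat & aexp.

Inductive cmd : Type :=
  | CSkip
  | CAssign of nat & aexp
  | CStore  of nat & aexp & aexp
  | CSeq    of cmd & cmd
  | CIf     of aexp & cmd & cmd
  | CWhile  of aexp & cmd.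

Record state : Type := State { vars : nat -> nat; mem : nat -> nat -> nat }.

Definition chk (W v : nat) : option nat := if v < W then Some v else None.

Fixpoint aeval (W : nat) (s : state) (a : aexp) : option nat :=
  let bin f a1 a2 :=
    match aeval W s a1, aeval W s a2 with
    | Some x, Some y => chk W (f x y)
    | _, _ => None
    end in
  match a with
  | ANum k => chk W k
  | AVar x => chk W (vars s x)
  | AAdd a1 a2 => bin addn a1 a2
  | ASub a1 a2 => bin subn a1 a2
  | AMul a1 a2 => bin muln a1 a2
  | ADiv a1 a2 => bin divn a1 a2
  | AMod a1 a2 => bin modn a1 a2
  | ALt a1 a2 => bin (fun x y => nat_of_bool (x < y)) a1 a2
  | AEq a1 a2 => bin (fun x y => nat_of_bool (x == y)) a1 a2
  | ALoad arr i =>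
      match aeval W s i with Some j => chk W (mem s arr j) | None => None end
  end.

Definition upd_var (s : state) (x v : nat) : state :=
  State (fun y => if y == x then v else vars s y) (mem s).

Definition upd_mem (s : state) (a i v : nat) : state :=
  State (vars s) (fun b j => if (b == a) && (j == i) then v else mem s b j).

Inductive exec (W : nat) : cmd -> state -> nat -> state -> Prop :=
  | ESkip s : exec W CSkip s 1 s
  | EAssign s x a v : aeval W s a = Some v -> exec W (CAssign x a) s 1 (upd_var s x v)
  | EStore s arr ai av i v :
      aeval W s ai = Some i -> aeval W s av = Some v ->
      exec W (CStore arr ai av) s 1 (upd_mem s arr i v)
  | ESeq c1 c2 s1 s2 s3 k1 k2 :
      exec W c1 s1 k1 s2 -> exec W c2 s2 k2 s3 -> exec W (CSeq c1 c2) s1 (k1 + k2) s3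
  | EIfT b c1 c2 s s' v k :
      aeval W s b = Some v -> v != 0 -> exec W c1 s k s' -> exec W (CIf b c1 c2) s k.+1 s'
  | EIfF b c1 c2 s s' k :
      aeval W s b = Some 0 -> exec W c2 s k s' -> exec W (CIf b c1 c2) s k.+1 s'
  | EWhileF b c s : aeval W s b = Some 0 -> exec W (CWhile b c) s 1 s
  | EWhileT b c s1 s2 s3 v k1 k2 :
      aeval W s1 b = Some v -> v != 0 -> exec W c s1 k1 s2 ->
      exec W (CWhile b c) s2 k2 s3 -> exec W (CWhile b c) s1 (k1 + k2).+1 s3.

(* Input encoding: variable 0 holds n; array 0 holds the adjacency matrix
   (entry u*n+v is 1 iff uv is an edge); array 1 holds the colors
   (entry u is 1 iff u has color 2); all other memory is 0. *)
Definition init_state n (e : rel 'I_n) (col : 'I_n -> bool) : state :=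
  State (fun x => if x == 0 then n else 0)
        (fun a i =>
           if a == 0 then
             nat_of_bool [exists u : 'I_n, exists v : 'I_n, (i == u * n + v) && e u v]
           else if a == 1 then
             nat_of_bool [exists u : 'I_n, (i == u) && col u]
           else 0).

Definition output_labeling n (s : state) : 'I_n -> nat := fun u => mem s 2 u.

(* Main.v *)
Require Import Defs.
From mathcomp Require Import all_boot.
From mathcomp Require Import zify.
Set Implicit Arguments. Unset Strict Implicit. Unset Printing Implicit Defensive.

(** The cost of a clustering is the number of edges plus the number of pairs inside
clusters minus twice the number of edges inside clusters.  A fair cluster has 3s vertices,
s of them red, and a forest has fewer edges than vertices inside it.  Counting therefore
shows that a fair clustering is never better than a suitable partial one: clusters of size
three are kept, a cluster of size six is replaced by one of its edges that can still be
extended by the right colors, and all larger clusters are dissolved.  So it suffices to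
maximize the number of kept edges over partial labelings with at most t = n / 3 classes,
each containing at most one red and two blue vertices; any such labeling can be completed
greedily to classes of exactly one red and two blue vertices, which are fair.

The maximization is a knapsack on the forest.  A vertex v with at most one remaining
neighbor p is removed over and over (p is a dummy root when v is isolated), and the table
of v is merged into that of p.  The table of v is indexed by the content of the class of v
inside the territory collected so far and by the number of other classes in use; each entry
stores a labeling realizing its value.  An optimal labeling q stays represented because a
class has at most three vertices: it cannot have edges in two disjoint territories, so the
class counts of territories add up. *)

(** * Edges of forests *)

(** Where the sizes three, six and nine come from: a fair cluster with k vertices contains k(k-1)/2
    pairs and at most k-1 edges, each worth 2, while triples on the same vertices contain only k
    pairs even if no edge is kept. From k = 9 on the triples win outright. At k = 6 the balance is
    15 - 10 = 5 against 6, off by exactly one, and a single retained edge repairs it.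

    The tables are controlled by two one-sided statements. Every positive entry is realized by its
    stored labeling, and every feasible labeling [q] is matched by some entry of at least its value.

    The obstacle in the second statement is the class of the top vertex. As long as it has no edge
    in the territory it must not be counted, since it may never earn anything; yet it must be
    available if it is continued outside. Hence [q] is represented twice: once in a form ready to be
    closed, with an exact count of the classes that own an edge, and once in a form ready to be
    joined, which leaves the top class out of the count. *)

Section ForestEdges.

Variables (n : nat) (e : rel 'I_n).
Implicit Types (U A : {set 'I_n}).

Definition edges_in U : {set 'I_n * 'I_n} :=
  [set x : 'I_n * 'I_n | [&& x.1 < x.2, e x.1 x.2, x.1 \in U & x.2 \in U]].

Definition pairs_in U : {set 'I_n * 'I_n} :=
  [set x : 'I_n * 'I_n | [&& x.1 < x.2, x.1 \in U & x.2 \in U]].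

Lemma card_pairs_in U : 2 * #|pairs_in U| + #|U| = #|U| * #|U|.
Proof.
pose swap (x : 'I_n * 'I_n) := (x.2, x.1).
have swapK : involutive swap by case.
have swapI : injective swap by apply: inv_inj.
pose S := setX U U; pose D := [set x : 'I_n * 'I_n | x.1 == x.2].
have cS : #|S| = #|U| * #|U| by rewrite cardsX.
have cD : #|S :&: D| = #|U|.
  rewrite -(card_imset U (f := fun u => (u, u))) => [|u v []//].
  apply: eq_card => -[u v]; rewrite !inE /=; apply/idP/imsetP.
    by case/andP=> /andP[uU _] /eqP <-; exists u.
  by case=> w wU [-> ->]; rewrite wU eqxx.
have cP : #|S :\: D| = #|pairs_in U| + #|swap @: pairs_in U|.
  rewrite -cardsUI; set I := _ :&: _.
  have -> : I = set0.
    apply/setP=> -[u v]; rewrite !inE /=; apply/negP => /andP[/andP[uv _]].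
    by case/imsetP=> -[a b]; rewrite inE /= => /andP[ab _] [ea eb]; subst; lia.
  rewrite cards0 addn0; apply: eq_card => -[u v]; rewrite !inE /=.
  have -> : ((u, v) \in swap @: pairs_in U) = ((v, u) \in pairs_in U).
    by rewrite -[(u, v)]/(swap (v, u)) (mem_imset _ _ swapI).
  rewrite !inE /= -val_eqE /= neq_ltn.
  by case: (u \in U); case: (v \in U); rewrite ?andbF ?andbT.
move: cP; rewrite card_imset // => cP.
by have := cardsID D S; rewrite cS cD cP => <-; rewrite mul2n -addnn addnC.
Qed.

Hypotheses (simple_e : simple_graph e) (forest_e : forest e).

(** If every vertex of [A] had two neighbors in [A], any path in [A] could be prolonged at its head:
    a neighbor lying on the path, other than the successor of the head, would close a cycle. But no
    path has [n + 1] distinct vertices. *)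
Lemma forest_leaf A :
  A != set0 -> exists2 v, v \in A & #|[set u in A | e v u]| <= 1.
Proof.
have [irr sym] := simple_e.
case/set0Pn=> a aA; apply/exists_inP; apply: contraT => /exists_inPn deg.
suff long k : exists x s, [/\ size s = k, uniq (x :: s), path e x s & {subset x :: s <= A}].
  have [x [s [sz us _ _]]] := long n.
  by have /card_uniqP /= cs := us; have := max_card (mem (x :: s)); rewrite cs sz card_ord ltnn.
elim: k => [|k [x [s [sz us ps sA]]]].
  by exists a, [::]; split=> // z; rewrite inE => /eqP ->.
have xA : x \in A by apply: sA; rewrite mem_head.
have := deg x xA; rewrite -ltnNge; set N := [set u in A | e x u] => N2.
have [/subsetP NS | /subsetPn[y]] := boolP (N \subset x :: s); last first.
  rewrite !inE => /andP[yA exy] ys; exists y, (x :: s); split=> //=.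
  - by rewrite sz.
  - by rewrite inE ys.
  - by rewrite sym exy.
  by move=> z; rewrite inE => /orP[/eqP -> // | /sA].
case: s sz us ps sA NS => [|y0 s'] sz us ps sA NS.
  have : N \subset [set x] by apply/subsetP=> z /NS; rewrite !inE.
  by move/subset_leq_card; rewrite cards1 leqNgt N2.
have [/subset_leq_card | /subsetPn[y yN yy0]] := boolP (N \subset [set y0]).
  by rewrite cards1 leqNgt N2.
have exy : e x y by move: yN; rewrite inE => /andP[].
have ys : y \in s'.
  have := NS y yN; rewrite !inE in yy0 *; rewrite (negbTE yy0) /=.
  by case: eqP => // yx; rewrite yx irr in exy.
case: forest_e; case/splitPr: ys us ps => p1 p2 us ps.
exists (x :: y0 :: rcons p1 y); apply/and3P; split.
- move: us; rewrite -cat_rcons -!cat_cons -rcons_cons cat_uniq.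
  by case/and3P.
- by rewrite /= size_rcons.
rewrite /cycle rcons_path; apply/andP; split.
  by move: ps; rewrite -cat_rcons -cat_cons cat_path => /andP[].
by rewrite /= last_rcons sym.
Qed.

Lemma card_edges_in U : #|edges_in U| <= #|U|.-1.
Proof.
have [irr sym] := simple_e.
elim: {U}_.+1 {-2}U (ltnSn #|U|) => // m IHm U Um.
have [-> | U0] := eqVneq U set0.
  suff -> : edges_in set0 = set0 by rewrite !cards0.
  by apply/setP=> x; rewrite !inE !andbF.
have [v vU leaf] := forest_leaf U0.
pose N := [set u in U | e v u].
pose f (u : 'I_n) : 'I_n * 'I_n := if v < u then (v, u) else (u, v).
have cU := cardsD1 v U; rewrite vU /= in cU.
have sub : edges_in U \subset edges_in (U :\ v) :|: f @: N.
  apply/subsetP=> -[x y]; rewrite !inE /= => /and4P[xy exy xU yU].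
  rewrite xy exy xU yU /= !andbT.
  have [xv | xv] /= := eqVneq x v.
    apply/imsetP; exists y; first by rewrite inE yU -xv exy.
    by rewrite /f -xv xy.
  have [yv | yv] //= := eqVneq y v.
  apply/imsetP; exists x; first by rewrite inE xU -yv sym exy.
  by rewrite /f -yv ltnNge ltnW.
(* This covers a singleton [U], where the truncated predecessor in the induction hypothesis would
   otherwise lose one. *)
have NU : N \subset U :\ v.
  apply/subsetP=> u; rewrite !inE => /andP[-> evu]; rewrite andbT.
  by apply: contraTneq evu => ->; rewrite irr.
have := IHm (U :\ v); have := subset_leq_card NU.
have := subset_leq_card sub; rewrite -/N in leaf; move: leaf.
have := (leq_card_setU (edges_in (U :\ v)) (f @: N)).1; have := leq_imset_card f N.
move: cU Um; set a := #|U|; set b := #|U :\ v|; set c := #|_ @: _|; set d := #|_ :|: _|.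
set g := #|N|; set h := #|edges_in U|; set i := #|edges_in _|.
move=> cU Um h1 h2 h3 h4 h5 h6; have {}h6 : i <= b.-1 by apply: h6; lia.
by clearbody a b c d g h i; lia.
Qed.

End ForestEdges.

(** * Partial labelings *)

Section LabelSoundness.

Variables (n : nat) (e : rel 'I_n) (col : 'I_n -> bool).
Implicit Types (L : 'I_n -> nat) (own : 'I_n -> nat).

Definition ncol L (b : bool) (l : nat) : nat :=
  #|[set u | (col u == b) && (L u == l)]|.

Definition intra L : {set 'I_n * 'I_n} :=
  [set x : 'I_n * 'I_n | [&& x.1 < x.2, e x.1 x.2, L x.1 == L x.2 & L x.1 != 0]].

(* A state 3 r + b stands for a class with r red (color 1) and b blue (color 2) vertices;
   state 0 means that the vertex is left unlabeled. *)
Definition scap (st : nat) (b : bool) : nat := if b then st %% 3 else st %/ 3.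

Definition joinable (s1 s2 : nat) : bool :=
  [&& 0 < s1, 0 < s2, s1 %/ 3 + s2 %/ 3 < 2 & s1 %% 3 + s2 %% 3 < 3].

(* Labels: 0 = unlabeled, 1 = the class of the top vertex, 2 .. j+1 = the other classes.
   For m = 1 the two top classes are united, for m = 0 the second one is closed and gets
   the new label j+1; [la] or [lb] is 0. *)
Definition join_label (m j1 j la lb : nat) : nat :=
  la + (lb == 1) * (m + (1 - m) * j.+1) + (1 < lb) * (lb + j1).

(** The state bounds the open class from above only. [sound_top] says that a nonzero state really
    has the top vertex in the open class, so that joining along an edge between top vertices gains
    this edge. *)
Record sound own (p st j w : nat) L : Prop := Sound {
  sound_terr : forall u, L u != 0 -> own u = p;
  sound_label : forall u, L u <= j.+1;
  sound_closed : forall l b, 1 < l -> ncol L b l <= b.+1;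
  sound_open : forall b, ncol L b 1 <= scap st b;
  sound_top : 0 < st -> exists2 u : 'I_n, u = p :> nat & L u = 1;
  sound_val : w <= #|intra L| }.

Lemma ncol_le L L' b l l' :
  (forall u, L u = l -> L' u = l') -> ncol L b l <= ncol L' b l'.
Proof.
move=> imp; apply/subset_leq_card/subsetP=> u; rewrite !inE.
by case/andP=> -> /eqP/imp ->; rewrite eqxx.
Qed.

Lemma eq_intra L L' : L =1 L' -> intra L = intra L'.
Proof. by move=> EL; apply/setP=> x; rewrite !inE !EL. Qed.

Lemma sound_ext own own' p st j w L L' :
  L =1 L' -> (forall u, own u = p -> own' u = p) ->
  sound own p st j w L -> sound own' p st j w L'.
Proof.
move=> EL Eown [terr label closed open top val]; split.
- by move=> u; rewrite -EL => /terr /Eown.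
- by move=> u; rewrite -EL.
- by move=> l b l1; apply: leq_trans (ncol_le b _) (closed l b l1) => u; rewrite EL.
- by move=> b; apply: leq_trans (ncol_le b _) (open b) => u; rewrite EL.
- by case/top=> u up L1; exists u; rewrite -?EL.
by rewrite -(eq_intra EL).
Qed.

Lemma scapD s1 s2 b : joinable s1 s2 -> scap (s1 + s2) b = scap s1 b + scap s2 b.
Proof. by case/and4P=> *; case: b; rewrite /scap; lia. Qed.

Lemma joinable_state s1 s2 : joinable s1 s2 -> 0 < s1 + s2 < 6.
Proof. by case/and4P=> *; lia. Qed.

Hypothesis sym : symmetric e.

(** The supports of the two labelings lie in different territories, so a vertex takes its new label
    from at most one of them, and class contents are added only in the united open class. The
    summand [m] of the value is the edge between [v] and [p]. *)
Lemma sound_merge own (p : nat) (v : 'I_n) m s1 s2 j1 j2 w1 w2 L1 L2 :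
  p != v :> nat -> m < 2 -> s2 < 6 -> (m == 1) ==> joinable s1 s2 ->
  (forall u : 'I_n, u = p :> nat -> e v u) ->
  sound own p s1 j1 w1 L1 -> sound own v s2 j2 w2 L2 ->
  let j := j1 + j2 + (1 - m) * (0 < s2) in
  sound (fun u => if own u == v then p else own u) p (s1 + m * s2) j (w1 + w2 + m)
    (fun u => join_label m j1 j (L1 u) (L2 u)).
Proof.
move=> pv m2 s26 jm adj S1 S2 j; set L := fun u => join_label _ _ _ _ _.
have disj u : (L1 u = 0) \/ (L2 u = 0).
  have [|n1] := eqVneq (L1 u) 0; first by left.
  have [|n2] := eqVneq (L2 u) 0; first by right.
  by move: pv; rewrite -(sound_terr S1 n1) -(sound_terr S2 n2) eqxx.
(* State 0 leaves no room for label 1, so closing the top class consumes a new label only if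
   [0 < s2]. *)
have no1 u : s2 = 0 -> L2 u <> 1.
  move=> s20 L2u; have := sound_open S2 (col u); rewrite s20.
  have -> : scap 0 (col u) = 0 by case: (col u).
  by rewrite leqNgt => /negP; apply; apply/card_gt0P; exists u; rewrite inE L2u !eqxx.
have lab1 := sound_label S1; have lab2 := sound_label S2.
have EL1 u : L1 u <> 0 -> L u = L1 u.
  by move=> h; rewrite /L /join_label; case: (disj u) => [/h //|->]; rewrite /= !mul0n !addn0.
have EL2 u : 1 < L2 u -> L u = L2 u + j1.
  move=> h; rewrite /L /join_label h; case: (disj u) => [->|]; last by lia.
  by case: eqP; lia.
have EL3 u : L2 u = 1 -> L u = if m == 1 then 1 else j.+1.
  move=> h; rewrite /L /join_label h /=; case: (disj u) => [->|]; last by lia.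
  by move: m2; case: (m) => [|[]] //=; lia.
have EL0 u : L1 u = 0 -> L2 u = 0 -> L u = 0.
  by move=> h1 h2; rewrite /L /join_label h1 h2.
have split4 u : [\/ L1 u <> 0 /\ L u = L1 u, 1 < L2 u /\ L u = L2 u + j1,
   [/\ L2 u = 1, L u = (if m == 1 then 1 else j.+1) & 0 < s2] | L u = 0].
  have [L10|] := eqVneq (L1 u) 0; last by move/eqP=> h; constructor 1; split; auto.
  case E: (L2 u) => [|[|k]]; first by constructor 4; auto.
    by constructor 3; split; auto; rewrite lt0n; apply/eqP=> /no1 /(_ E).
  by constructor 2; split=> //; rewrite -E EL2 // E.
split.
- move=> u Lu; have [[h _]|[h _]|[h _ _]|h] := split4 u.
  + have -> : own u = p by apply: (sound_terr S1); apply/eqP.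
    by rewrite (negbTE pv).
  + by rewrite (sound_terr S2) ?eqxx //; lia.
  + by rewrite (sound_terr S2) ?eqxx //; lia.
  by rewrite h in Lu.
- move=> u; have l1 := lab1 u; have l2 := lab2 u; rewrite /j.
  by have [[_ ->]|[_ ->]|[_ -> h]|->] := split4 u; try case: eqP; lia.
- move=> l b l1.
  (* Closed labels fall into three ranges: those of [L1], the closed ones of [L2] shifted by [j1],
     and above them the top class of [v] if it has just been closed. *)
  have [lj | lj] := leqP l j1.+1.
    apply: leq_trans (ncol_le b _) (sound_closed S1 b l1) => u Lu.
    have l2 := lab2 u.
    have [[? ]|[? ]|[_ h s]|] := split4 u; rewrite ?Lu; try lia.
    by move: h; rewrite Lu /j; case: ifP; lia.
  have [lj2 | lj2] := leqP l (j1 + j2.+1).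
    have l1' : 1 < l - j1 by lia.
    apply: leq_trans (ncol_le b _) (sound_closed S2 b l1') => u Lu.
    have l2 := lab1 u.
    have [[? ]|[? ]|[_ h s]|] := split4 u; rewrite ?Lu; try lia.
    by move: h; rewrite Lu /j; case: eqP; lia.
  apply: (@leq_trans (ncol L2 b 1)).
    apply: ncol_le => u Lu; have l2 := lab1 u; have l3 := lab2 u.
    by have [[? ]|[? ]|[-> h s]|] := split4 u; rewrite ?Lu //; lia.
  by apply: leq_trans (sound_open S2 b) _; rewrite /scap; case: b; lia.
- move=> b.
  have -> : scap (s1 + m * s2) b = scap s1 b + m * scap s2 b.
    by move: m2 jm; case: (m) => [|[]] //= _ H; rewrite ?mul0n ?addn0 ?mul1n // scapD.
  apply: (@leq_trans (ncol L1 b 1 + m * ncol L2 b 1)); last first.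
    by rewrite leq_add ?leq_mul ?(sound_open S1) ?(sound_open S2).
  have [m1 | m1] := eqVneq m 1.
    rewrite m1 mul1n; apply: leq_trans (leq_card_setU _ _).1.
    apply/subset_leq_card/subsetP=> u; rewrite !inE => /andP[-> /eqP Lu] /=.
    by have [[? ]|[? ]|[h _ _]|] := split4 u; rewrite ?Lu => *; lia.
  have -> : m = 0 by lia.
  rewrite mul0n addn0; apply: ncol_le => u Lu.
  have [[? ]|[? ]|[_ h s]|] := split4 u; rewrite ?Lu; try lia.
  by move: h; rewrite Lu /j (negbTE m1); lia.
- move=> s0; have [|u up L1u] := sound_top S1.
    by move: m2 jm s0; case: (m) => [|[]] //= _; [rewrite addn0 | case/and4P].
  by exists u => //; rewrite EL1 L1u.
have sub1 : intra L1 \subset intra L.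
  apply/subsetP=> -[x y]; rewrite !inE /= => /and4P[-> -> /eqP E /eqP n0].
  by rewrite !EL1 -?E //= eqxx; apply/eqP.
have sub2 : intra L2 \subset intra L.
  apply/subsetP=> -[x y]; rewrite !inE /= => /and4P[-> -> /eqP E /eqP n0] /=.
  have [E1|E1] := eqVneq (L2 x) 1.
    by rewrite !EL3 -?E // eqxx; case: ifP.
  by rewrite !EL2 -?E ?eqxx /=; lia.
have d12 : intra L1 :&: intra L2 = set0.
  apply/setP=> -[x y]; rewrite !inE /=; apply/negP.
  by case/andP=> /and4P[_ _ _ a] /and4P[_ _ _ b]; case: (disj x) => h; rewrite h in a b.
have c12 : #|intra L1 :|: intra L2| = #|intra L1| + #|intra L2|.
  by rewrite -cardsUI d12 cards0 addn0.
have le12 : w1 + w2 <= #|intra L1 :|: intra L2|.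
  by rewrite c12 leq_add ?(sound_val S1) ?(sound_val S2).
have sub12 : intra L1 :|: intra L2 \subset intra L by rewrite subUset sub1.
have [m1 | m1] := eqVneq m 1; last first.
  have -> : m = 0 by lia.
  by rewrite addn0; apply: leq_trans le12 (subset_leq_card sub12).
have /and4P[s10 s20 _ _] : joinable s1 s2 by rewrite m1 in jm.
have [u up L1u] := sound_top S1 s10; have [v' v'v L2v] := sound_top S2 s20.
have ev : v' = v by apply: val_inj.
rewrite {v' v'v}ev in L2v.
have Lu : L u = 1 by rewrite EL1 L1u.
have Lv : L v = 1 by rewrite EL3 // m1.
have L1v : L1 v = 0 by case: (disj v); rewrite ?L2v.
have L2u : L2 u = 0 by case: (disj u); rewrite ?L1u.
pose x := if u < v then (u, v) else (v, u).
have xI : x \in intra L.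
  rewrite /x; case: ltnP => uv; rewrite inE /= Lu Lv ?uv ?[e u v]sym adj //=.
  by move: pv; rewrite -up; lia.
have xN : x \notin intra L1 :|: intra L2.
  by rewrite /x; case: ifP; rewrite !inE /= ?L1v ?L1u ?L2u ?L2v ?andbF.
rewrite m1 addn1; apply: leq_ltn_trans le12 _; apply: proper_card.
by apply/properP; split=> //; exists x.
Qed.

End LabelSoundness.

(** * Dynamic programming tables *)

Section Tables.

Variables (n : nat) (e : rel 'I_n) (col : 'I_n -> bool) (t : nat).
Implicit Types (own : 'I_n -> nat) (q : 'I_n -> option 'I_n) (U : {set 'I_n}).
Implicit Types (T : nat -> nat -> nat -> nat) (L : nat -> nat -> nat -> 'I_n -> nat).

(* [own u] is the remaining vertex that has absorbed [u], or [n] for the dummy root. *)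
Definition terr own (p : nat) : {set 'I_n} := [set u | own u == p].

Definition live own (p : nat) : Prop :=
  p = n \/ exists2 v : 'I_n, p = v & own v = v.

Definition kept q U : {set 'I_n * 'I_n} :=
  [set x in edges_in e U | (q x.1 == q x.2) && (q x.1 != None)].

(** Classes without an edge inside [U] earn nothing there and are not charged. Together with the
    size bound three, this convention makes the counts of disjoint territories additive. *)
Definition kept_classes q U : {set 'I_n} :=
  [set l | [exists x in kept q U, q x.1 == Some l]].

Definition class_of q (l : 'I_n) : {set 'I_n} := [set u | q u == Some l].

Definition color_count (b : bool) U : nat := #|[set u in U | col u == b]|.

Definition feasible q : Prop :=
  (forall l b, color_count b (class_of q l) <= b.+1) /\
  #|kept_classes q setT| <= t.

(** The top class may still be open; [(0 < st)] charges it exactly as a merge with [m = 0] does when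
    it closes it. *)
Definition closable q U (TT : nat -> nat -> nat) : Prop :=
  exists st j, [/\ st < 6, #|kept q U| < TT st j & j + (0 < st) = #|kept_classes q U|].

(** The class [l] is left out of [j] even if it has an edge, because it is charged when it is
    closed. The state must not exceed the true content of [l], so that the capacities respected by
    [q] make states joinable. *)
Definition openable q U l (TT : nat -> nat -> nat) : Prop :=
  exists st j, [/\ 0 < st < 6, #|kept q U| < TT st j, j = #|kept_classes q U :\ l|
    & forall b, scap st b <= color_count b (class_of q l :&: U)].

(* Entries are 1 + (number of kept edges), with 0 for an infeasible entry.  [openable] is
   only required of classes that leave the territory: only those can still be joined. *)
Record dp_inv own T L : Prop := DPInv {
  inv_own : forall u, live own (own u);
  inv_cross : forall u v, e u v -> own u <> own v -> own u = u /\ own v = v;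
  inv_sound : forall p st j w, live own p -> st < 6 -> j <= t ->
    T p st j = w.+1 -> sound e col own p st j w (L p st j);
  inv_closable : forall q (v : 'I_n), feasible q -> own v = v ->
    closable q (terr own v) (T v);
  inv_openable : forall q (v : 'I_n) l, feasible q -> own v = v -> q v = Some l ->
    ~~ (class_of q l \subset terr own v) -> openable q (terr own v) l (T v);
  inv_root : forall q j, feasible q -> #|kept_classes q (terr own n)| <= j -> j <= t ->
    #|kept q (terr own n)| < T n 0 j }.

Definition combination T p v m s1 s2 j1 j2 : Prop :=
  [/\ m < 2, s1 < 6, s2 < 6, j1 <= t & j2 <= t] /\
  [/\ 0 < T p s1 j1, 0 < T v s2 j2 & (m == 1) ==> joinable s1 s2].

Hypotheses (simple_e : simple_graph e) (forest_e : forest e).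

Lemma card_class q l : feasible q -> #|class_of q l| <= 3.
Proof.
case=> cap _; have h1 := cap l true; have h2 := cap l false.
suff -> : #|class_of q l| = color_count true (class_of q l) + color_count false (class_of q l).
  by rewrite -[3]/(2 + 1) leq_add.
rewrite /color_count -cardsUI; set I := _ :&: _.
have -> : I = set0.
  by apply/setP=> u; rewrite !inE; case: (col u); rewrite ?andbF.
rewrite cards0 addn0; apply: eq_card => u; rewrite !inE.
by case: (col u); rewrite ?andbF ?andbT ?orbF.
Qed.

Lemma kept_classesP q U l :
  reflect (exists x y : 'I_n, [/\ x < y, e x y, x \in U, y \in U & q x = Some l /\ q y = Some l])
    (l \in kept_classes q U).
Proof.
rewrite inE; apply: (iffP (exists_inP)).
  case=> -[x y]; rewrite !inE /= => /andP[/and4P[xy exy xU yU] /andP[/eqP E _]] /eqP ql.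
  by exists x, y; split=> //; rewrite -E.
case=> x [y [xy exy xU yU [qx qy]]]; exists (x, y); rewrite ?qx //.
by rewrite !inE /= xy exy xU yU qx qy /= eqxx.
Qed.

Lemma kept_classesS q U U' : U \subset U' -> kept_classes q U \subset kept_classes q U'.
Proof.
move=> /subsetP sU; apply/subsetP=> l /kept_classesP[x [y [xy exy xU yU h]]].
by apply/kept_classesP; exists x, y; split; auto.
Qed.

Lemma kept_classes_disjoint q U U' : feasible q -> [disjoint U & U'] ->
  [disjoint kept_classes q U & kept_classes q U'].
Proof.
move=> fq dU; rewrite disjoint_subset; apply/subsetP=> l.
case/kept_classesP=> x [y [xy _ xU yU [qx qy]]]; apply/negP.
case/kept_classesP=> x' [y' [xy' _ xU' yU' [qx' qy']]].
have := card_class l fq; apply/negP; rewrite -ltnNge.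
have neq a b : a \in U -> b \in U' -> a != b.
  by move=> aU; apply: contraTneq => <-; rewrite (disjointFr dU).
suff us : uniq [:: x; y; x'; y'].
  rewrite -[4]/(size [:: x; y; x'; y']) -(card_uniqP us); apply/subset_leq_card/subsetP=> z.
  by rewrite !inE => /or4P[] /eqP ->; apply/eqP.
rewrite /= !inE !negb_or (neq x x') // (neq x y') // (neq y x') // (neq y y') //.
by rewrite -!val_eqE /= !neq_ltn xy xy'.
Qed.

Variables (own : 'I_n -> nat) (T : nat -> nat -> nat -> nat)
  (L : nat -> nat -> nat -> 'I_n -> nat).
Hypothesis inv : dp_inv own T L.

Variables (p : nat) (v : 'I_n) (T' : nat -> nat -> nat) (L' : nat -> nat -> 'I_n -> nat).
Hypotheses (live_p : live own p) (live_v : own v = v) (pv : p != v :> nat).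
Hypothesis nbr_v : forall u : 'I_n, own u = u -> e v u -> u = p :> nat.
Hypothesis edge_vp : forall u : 'I_n, u = p :> nat -> e v u.

(** The interface to the program: [upper] says that entries come from combinations, [lower] that
    they are at least as large as every admissible one. No maximum is written down, so the order in
    which combinations are tried is irrelevant. Since each entry is one more than its value, adding
    two of them requires subtracting 1. *)
Hypothesis upper : forall st j w, st < 6 -> j <= t -> T' st j = w.+1 ->
  exists m s1 s2 j1 j2, combination T p v m s1 s2 j1 j2 /\
    [/\ st = s1 + m * s2, j = j1 + j2 + (1 - m) * (0 < s2),
        w.+1 = T p s1 j1 + T v s2 j2 + m - 1
      & L' st j =1 fun u => join_label m j1 j (L p s1 j1 u) (L v s2 j2 u)].

Hypothesis lower : forall m s1 s2 j1 j2, combination T p v m s1 s2 j1 j2 ->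
  j1 + j2 + (1 - m) * (0 < s2) <= t -> T p s1 j1 + T v s2 j2 + m - 1 <= n ->
  T p s1 j1 + T v s2 j2 + m - 1 <= T' (s1 + m * s2) (j1 + j2 + (1 - m) * (0 < s2)).

Let own' u := if own u == v then p else own u.
Let U1 := terr own p.
Let U2 := terr own v.
Let U' := terr own' p.

Let U'E : U' = U1 :|: U2.
Proof.
apply/setP=> u; rewrite !inE /own'.
by case: (eqVneq (own u) v) => [->|]; rewrite ?eqxx ?orbT ?orbF.
Qed.

Let dU : [disjoint U1 & U2].
Proof.
rewrite disjoint_subset; apply/subsetP=> u; rewrite !inE => /eqP ->; exact: pv.
Qed.

Let terr'E (p' : nat) : p' != p -> p' != v :> nat -> terr own' p' = terr own p'.
Proof.
move=> pp pv'; apply/setP=> u; rewrite !inE /own'; case: (eqVneq (own u) v) => [->|//].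
by rewrite eq_sym (negbTE pp) eq_sym (negbTE pv').
Qed.

Let live' (p' : nat) : live own' p' -> live own p' /\ p' != v :> nat.
Proof.
case=> [->|[u -> ou]]; first by split; [left | have := ltn_ord v; lia].
have uv : u != v :> nat.
  move: ou; rewrite /own'; case: eqP => [_ <- //| ne ou]; apply/eqP=> uv; case: ne.
  by rewrite ou uv.
split=> //; right; exists u => //; move: ou; rewrite /own'.
case: eqP => // E up; case: live_p => [pn | [u' pu' ou']].
  by have := ltn_ord u; lia.
by have -> : u = u' by apply: val_inj; rewrite /= -up.
Qed.

Let own'P (p' : 'I_n) : own' p' = p' -> own p' = p' /\ p' != v :> nat.
Proof.
move=> h; have [|[pn|[u pu ou]] ?] := live' (p' := p'); first by right; exists p'.
  by have := ltn_ord p'; lia.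
by split=> //; have -> : p' = u by apply: val_inj.
Qed.

(** Edges between territories join remaining vertices, and [v] has no remaining neighbor but [p]. *)
Let cross12 x y : x \in U1 -> y \in U2 -> e x y -> x = p :> nat /\ y = v.
Proof.
rewrite !inE => /eqP x1 /eqP y2 exy.
have [|ox oy] := inv_cross inv exy; first by rewrite x1 y2; apply/eqP.
have yv : y = v by apply: val_inj; rewrite /= -oy y2.
by split=> //; apply: nbr_v ox _; rewrite -yv (simple_e.2).
Qed.

Lemma new_sound st j w : st < 6 -> j <= t -> T' st j = w.+1 ->
  sound e col own' p st j w (L' st j).
Proof.
move=> st6 jt Tw.
have [m [s1 [s2 [j1 [j2 [[]]]]]]] := upper st6 jt Tw.
case=> m2 s16 s26 j1t j2t [T1 T2 jm] [Est Ej Ew EL].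
have S1 := inv_sound inv live_p s16 j1t (esym (prednK T1)).
have S2 := inv_sound inv (or_intror (ex_intro2 _ _ v erefl live_v)) s26 j2t (esym (prednK T2)).
have := sound_merge simple_e.2 pv m2 s26 jm edge_vp S1 S2.
rewrite /= -Ej -Est.
have -> : (T p s1 j1).-1 + (T v s2 j2).-1 + m = w by lia.
by apply: sound_ext => // u; rewrite EL.
Qed.

(** The united labeling realizes the value, and a forest has fewer than [n] edges. Hence the size
    guard in [lower], which mirrors a test of the program, never rejects a combination. *)
Lemma combination_le m s1 s2 j1 j2 : combination T p v m s1 s2 j1 j2 ->
  T p s1 j1 + T v s2 j2 + m - 1 <= n.
Proof.
case=> -[m2 s16 s26 j1t j2t] [T1 T2 jm].
have S1 := inv_sound inv live_p s16 j1t (esym (prednK T1)).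
have S2 := inv_sound inv (or_intror (ex_intro2 _ _ v erefl live_v)) s26 j2t (esym (prednK T2)).
have /sound_val := sound_merge simple_e.2 pv m2 s26 jm edge_vp S1 S2.
set I := intra _ _ => le.
have : #|I| <= #|edges_in e setT|.
  by apply/subset_leq_card/subsetP=> x; rewrite !inE => /and4P[-> ->].
move/leq_trans/(_ (card_edges_in simple_e forest_e _)); rewrite cardsT card_ord.
have := ltn_ord v; move: le; lia.
Qed.

Section OneLabeling.

Variable q : 'I_n -> option 'I_n.
Hypothesis fq : feasible q.

Let disjJ : [disjoint kept_classes q U1 & kept_classes q U2].
Proof. exact: kept_classes_disjoint. Qed.

Let leJ (A : {set 'I_n}) l : #|kept_classes q A :\ l| <= t.
Proof.
apply: leq_trans fq.2; apply: subset_leq_card.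
by apply: subset_trans (subD1set _ _) (kept_classesS q (subsetT _)).
Qed.

Let leJ' (A : {set 'I_n}) : #|kept_classes q A| <= t.
Proof. by apply: leq_trans fq.2; apply/subset_leq_card/kept_classesS/subsetT. Qed.

(** * Labelings that do not keep the edge between [p] and [v] *)

Section Unjoined.

Hypothesis unjoined : forall u : 'I_n, u = p :> nat -> q u = q v -> q v = None.

Let keptE : kept q U' = kept q U1 :|: kept q U2.
Proof.
apply/setP=> -[x y]; rewrite U'E; apply/idP/idP; last first.
  by rewrite !inE /= => /orP[] /andP[/and4P[-> -> -> ->] ->]; rewrite ?orbT.
move=> xyK; move: (xyK); rewrite !inE /= => /andP[/and4P[-> exy xU yU] /andP[/eqP E qx]].
rewrite exy E eqxx -E qx /= !andbT.
case/orP: xU => xU; case/orP: yU => yU; rewrite xU yU ?orbT //.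
  have [|||xp yv] := @cross12 x y; rewrite ?inE //.
  by move: qx; rewrite E yv (unjoined xp) // E yv.
have [|||yp xv] := @cross12 y x; rewrite ?inE // 1?(simple_e.2) //.
by move: qx; rewrite xv (unjoined yp) // -E xv.
Qed.

Let keptcE : kept_classes q U' = kept_classes q U1 :|: kept_classes q U2.
Proof.
apply/setP=> l; rewrite [RHS]inE ![_ \in kept_classes _ _]inE keptE.
apply/exists_inP/orP => [[x]|[] /exists_inP[x xK ql]].
- by rewrite inE => /orP[] xK ql; [left | right]; apply/exists_inP; exists x.
- by exists x => //; rewrite inE xK.
by exists x => //; rewrite inE xK orbT.
Qed.

Let cardK : #|kept q U'| <= #|kept q U1| + #|kept q U2|.
Proof. by rewrite keptE (leq_card_setU _ _).1. Qed.

Let cardJ : #|kept_classes q U'| = #|kept_classes q U1| + #|kept_classes q U2|.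
Proof. by rewrite keptcE; apply/eqP; rewrite (leq_card_setU _ _).2. Qed.

(** Whatever state [closable] supplies at [v], closing it costs [(0 < s2)], which brings the charge
    for [U2] to its exact number of kept classes. *)
Let close_v s1 j1 j : s1 < 6 -> j1 <= t -> #|kept q U1| < T p s1 j1 -> j <= t ->
  j1 + #|kept_classes q U2| = j -> #|kept q U'| < T' s1 j.
Proof.
move=> s16 j1t K1 jt Ej.
have [s2 [j2 [s26 K2 J2]]] := inv_closable inv fq live_v; rewrite -/U2 in K2 J2.
have C : combination T p v 0 s1 s2 j1 j2.
  split=> //; split=> //; try lia.
have := lower C; have := combination_le C; rewrite mul0n !addn0 mul1n -addnA J2 Ej.
move=> cl /(_ jt cl); apply: leq_trans.
by move: cardK; lia.
Qed.

Lemma unjoined_closable : p < n -> closable q U' T'.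
Proof.
move=> pn; case: live_p => [|[u pu ou]]; first by lia.
have [s1 [j1]] := inv_closable inv fq ou; rewrite -pu -/U1 => -[s16 K1 J1].
exists s1, (j1 + #|kept_classes q U2|).
have jt := leJ' U'; rewrite cardJ in jt.
by split=> //; [apply: (close_v (j1 := j1)) => //; lia | rewrite cardJ; lia].
Qed.

Lemma unjoined_openable (u : 'I_n) l : u = p :> nat -> q u = Some l ->
  ~~ (class_of q l \subset U') -> openable q U' l T'.
Proof.
move=> up ql cU'; case: live_p => [|[u' pu' ou]]; first by have := ltn_ord u; lia.
have {pu'} Eu : u' = u by apply: val_inj; rewrite /= up.
subst u'; have cU1 : ~~ (class_of q l \subset U1).
  by apply: contra cU' => /subset_trans; apply; rewrite U'E subsetUl.
have [s1 [j1]] := inv_openable inv fq ou ql ltac:(by rewrite up).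
rewrite up -/U1 => -[s16 K1 J1 cap].
(* Class [l] contains [u] in [U1] and some [z] outside [U']; an edge of [l] in [U2] would raise it
   to four vertices. *)
have lJ2 : l \notin kept_classes q U2.
  apply/negP=> /kept_classesP[x [y [xy _ xU yU [qx qy]]]].
  case/subsetPn: cU' => z; rewrite U'E !inE => ql' /norP[z1 z2].
  have := card_class l fq; apply/negP; rewrite -ltnNge.
  rewrite !inE in xU yU.
  suff us : uniq [:: x; y; z; u].
    rewrite -[4]/(size [:: x; y; z; u]) -(card_uniqP us); apply/subset_leq_card/subsetP=> a.
    by rewrite !inE => /or4P[] /eqP -> //; apply/eqP.
  have neq (a b : 'I_n) : own a != own b -> a != b by apply: contraNneq => ->.
  have xy' : x != y by rewrite -val_eqE /= neq_ltn xy.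
  rewrite /= !inE !negb_or xy' !neq ?(eqP xU) ?(eqP yU) ?ou ?up //.
  - by rewrite eq_sym.
  - by rewrite eq_sym.
  - by rewrite eq_sym.
  by rewrite eq_sym.
have JE : kept_classes q U' :\ l = (kept_classes q U1 :\ l) :|: kept_classes q U2.
  rewrite keptcE setDUl; congr (_ :|: _); apply/setP=> a; rewrite in_setD1.
  by case: eqP => // ->; rewrite (negbTE lJ2).
have cJ : #|kept_classes q U' :\ l| = j1 + #|kept_classes q U2|.
  rewrite JE J1; apply/eqP; rewrite (leq_card_setU _ _).2.
  exact: disjointWl (subD1set _ _) disjJ.
exists s1, (j1 + #|kept_classes q U2|); split=> //.
- apply: (close_v (j1 := j1)) => //; first by lia.
    by rewrite J1 leJ.
  by rewrite -cJ leJ.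
- move=> b; apply: leq_trans (cap b) (subset_leq_card _).
  by apply/subsetP=> a; rewrite U'E !inE => /andP[/andP[-> ->] ->].
Qed.

(** At the root [j] is only an upper bound on the classes in use, so the budget left after paying
    for [U2] can be passed to the old root table as it is. *)
Lemma unjoined_root j : p = n -> #|kept_classes q U'| <= j -> j <= t -> #|kept q U'| < T' 0 j.
Proof.
rewrite cardJ => pn Jj jt.
apply: (close_v (j1 := j - #|kept_classes q U2|)) => //; try lia.
have R := inv_root inv (q := q) (j := j - #|kept_classes q U2|) fq.
have E1 : terr own n = U1 by rewrite /U1 pn.
have E2 : T n 0 = T p 0 by rewrite pn.
by rewrite E1 E2 in R; apply: R; lia.
Qed.

End Unjoined.

(** * Labelings that keep the edge between [p] and [v] *)

Section Joined.

Variables (u l : 'I_n).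
Hypotheses (up : u = p :> nat) (qu : q u = Some l) (qv : q v = Some l).

Let ou : own u = u.
Proof.
case: live_p => [|[u' pu' ou]]; first by have := ltn_ord u; lia.
by have -> : u = u' by apply: val_inj; rewrite /= up.
Qed.

Let uU1 : u \in U1. Proof. by rewrite inE ou up. Qed.
Let vU2 : v \in U2. Proof. by rewrite inE live_v. Qed.

Let edge := if u < v then (u, v) else (v, u).

Let keptS : kept q U' \subset kept q U1 :|: kept q U2 :|: [set edge].
Proof.
apply/subsetP=> -[x y]; rewrite U'E !inE /=.
case/andP=> /and4P[xy exy xU yU] /andP[/eqP E qx]; rewrite xy exy E eqxx -E qx /= !andbT.
case/orP: xU => xU; case/orP: yU => yU; rewrite xU yU ?orbT //.
  have [|||xp yv] := @cross12 x y; rewrite ?inE //.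
  rewrite -up in xp; move/val_inj: xp => xu; rewrite xu yv in xy.
  by rewrite /edge xy xu yv eqxx orbT.
have [|||yp xv] := @cross12 y x; rewrite ?inE // 1?(simple_e.2) //.
rewrite -up in yp; move/val_inj: yp => yu; rewrite yu xv in xy.
by rewrite /edge ltnNge ltnW // yu xv eqxx orbT.
Qed.

Let cardK : #|kept q U'| <= #|kept q U1| + #|kept q U2| + 1.
Proof.
apply: leq_trans (subset_leq_card keptS) _.
apply: leq_trans (leq_card_setU _ _).1 _; rewrite cards1 leq_add2r.
exact: (leq_card_setU _ _).1.
Qed.

Let keptcE : kept_classes q U' :\ l = (kept_classes q U1 :\ l) :|: (kept_classes q U2 :\ l).
Proof.
apply/setP=> a; rewrite -setDUl !in_setD1; case: eqVneq => //= al.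
rewrite [RHS]inE; apply/idP/orP; last first.
  by case; apply/subsetP/kept_classesS; rewrite U'E ?subsetUl ?subsetUr.
rewrite inE => /exists_inP[x /(subsetP keptS)]; rewrite !in_setU in_set1.
case/orP=> [/orP[] xK qa|/eqP ->].
- by left; rewrite inE; apply/exists_inP; exists x.
- by right; rewrite inE; apply/exists_inP; exists x.
by rewrite /edge; case: ifP => _ /=; rewrite ?qu ?qv => /eqP[la]; rewrite la eqxx in al.
Qed.

Let cardJ : #|kept_classes q U' :\ l| = #|kept_classes q U1 :\ l| + #|kept_classes q U2 :\ l|.
Proof.
rewrite keptcE; apply/eqP; rewrite (leq_card_setU _ _).2.
exact: disjointW (subD1set _ _) (subD1set _ _) disjJ.
Qed.

(** In both territories the class [l] leaves, as it contains the top vertex of the other one, so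
    [inv_openable] applies twice. The two states are bounded by disjoint parts of [l], and the
    capacity of [l] makes them joinable. *)
Lemma joined_openable : openable q U' l T'.
Proof.
have c1 : ~~ (class_of q l \subset terr own u).
  apply/subsetPn; exists v; first by rewrite inE qv.
  by rewrite inE live_v up eq_sym.
have c2 : ~~ (class_of q l \subset terr own v).
  apply/subsetPn; exists u; first by rewrite inE qu.
  by rewrite inE ou up.
have [s1 [j1]] := inv_openable inv fq ou qu c1; rewrite up -/U1 => -[/andP[s10 s16] K1 J1 cap1].
have [s2 [j2]] := inv_openable inv fq live_v qv c2; rewrite -/U2 => -[/andP[s20 s26] K2 J2 cap2].
have cap b : scap s1 b + scap s2 b <= color_count b (class_of q l :&: U').
  apply: leq_trans (leq_add (cap1 b) (cap2 b)) _.
  pose A U := [set a in class_of q l :&: U | col a == b].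
  have dA : [disjoint A U1 & A U2].
    by apply: disjointW dU; apply/subsetP=> a; rewrite !inE => /andP[/andP[]].

  rewrite -[X in X <= _]/(#|A U1| + #|A U2|).
  have /eqP <- : #|A U1 :|: A U2| == #|A U1| + #|A U2| by rewrite (leq_card_setU _ _).2.
  apply/subset_leq_card/subsetP=> a; rewrite U'E !inE.
  by case/orP=> /andP[/andP[-> ->] ->]; rewrite ?orbT.
have cap' b : scap s1 b + scap s2 b <= b.+1.
  apply: leq_trans (cap b) (leq_trans _ (fq.1 l b)).
  by apply/subset_leq_card/subsetP=> a; rewrite !inE => /andP[/andP[-> _] ->].
have jn : joinable s1 s2.
  by have := cap' true; have := cap' false; rewrite /scap /joinable s10 s20 /= => h1 h2; rewrite !ltnS h1 h2.
have C : combination T p v 1 s1 s2 j1 j2.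
  split; first by split=> //; rewrite ?J1 ?J2 leJ.
  by split=> //; [apply: leq_ltn_trans K1 | apply: leq_ltn_trans K2].
have Ej : j1 + j2 = #|kept_classes q U' :\ l| by rewrite cardJ J1 J2.
have := lower C; rewrite mul1n subnn mul0n addn0 Ej => /(_ (leJ _ _) (combination_le C)) low.
exists (s1 + s2), #|kept_classes q U' :\ l|; split=> //.
- exact: joinable_state.
- apply: leq_ltn_trans cardK _; apply: leq_trans low.
  by rewrite addnK addn1 -addSn -addnS leq_add.
by move=> b; rewrite scapD.
Qed.

(** The edge just gained makes [l] a kept class of [U'], so the nonzero state is charged for exactly
    this class. *)
Lemma joined_closable : closable q U' T'.
Proof.
have [st [j [/andP[st0 st6] K J _]]] := joined_openable.
exists st, j; split=> //; rewrite J st0 [RHS](cardsD1 l) addnC; congr (_ + _).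
suff -> : l \in kept_classes q U' by [].
have euv : e u v by rewrite simple_e.2 edge_vp.
have uv : u != v :> nat by rewrite up.
have uU : u \in U' by rewrite U'E inE uU1.
have vU : v \in U' by rewrite U'E inE vU2 orbT.
apply/kept_classesP; case: (ltnP u v) => [lt | le]; first by exists u, v; split.
exists v, u; split=> //; first by rewrite ltn_neqAle eq_sym uv le.
by rewrite simple_e.2.
Qed.

End Joined.

Lemma joinedP : (forall u : 'I_n, u = p :> nat -> q u = q v -> q v = None) \/
  exists u l : 'I_n, [/\ u = p :> nat, q u = Some l & q v = Some l].
Proof.
case qv : (q v) => [l|]; last by left.
have [/existsP[u /andP[/eqP up /eqP qu]]|no] :=
  boolP [exists u : 'I_n, (u == p :> nat) && (q u == Some l)].
  by right; exists u, l.
left=> u up qu; case/existsP: no; exists u; rewrite qu up !eqxx //.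
Qed.

Lemma new_closable : p < n -> closable q U' T'.
Proof.
move=> pn; have [un | [u [l [up qu qv]]]] := joinedP; first exact: unjoined_closable.
exact: joined_closable up qu qv.
Qed.

Lemma new_openable (u : 'I_n) l : u = p :> nat -> q u = Some l ->
  ~~ (class_of q l \subset U') -> openable q U' l T'.
Proof.
move=> up qu cU; have [un | [u' [l' [up' qu' qv]]]] := joinedP.
  exact: unjoined_openable up qu cU.
have Eu : u' = u by apply: val_inj; rewrite /= up up'.
rewrite Eu qu in qu'; case: qu' => <- in qv *.
exact: joined_openable up qu qv.
Qed.

Lemma new_root j : p = n -> #|kept_classes q U'| <= j -> j <= t -> #|kept q U'| < T' 0 j.
Proof.
move=> pn; apply: unjoined_root => // u; rewrite pn => un.
by have := ltn_ord u; rewrite un ltnn.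
Qed.

End OneLabeling.

(** Only the territory of [p] grows and only [v] stops being live; all other tables keep their
    guarantees. *)
Lemma dp_inv_merge :
  dp_inv own' (fun p' => if p' == p then T' else T p') (fun p' => if p' == p then L' else L p').
Proof.
have live_p' : live own' p.
  case: live_p => [->|[u pu ou]]; first by left.
  right; exists u => //; rewrite /own' ou -pu; by rewrite (negbTE pv).
split.
- move=> u; rewrite /own'; case: eqP => // ov.
  case: (inv_own inv u) => [->|[a oua oa]]; first by left.
  right; exists a => //; rewrite oa.
  by case: eqP => // av; case: ov; rewrite oua av.
- move=> x y exy; rewrite /own'.
  have [xy | /eqP xy] := eqVneq (own x) (own y); first by rewrite xy.
  have [ox oy] := inv_cross inv exy xy.
  case: eqP => xv; case: eqP => yv //.
  + by move=> h; case: h; rewrite oy; symmetry; apply: nbr_v => //;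
      rewrite -(val_inj (etrans (esym ox) xv)).
  + move=> h; case: h; rewrite ox; apply: nbr_v => //.
    by rewrite -(val_inj (etrans (esym oy) yv)) simple_e.2.
- move=> p' st j w lp' st6 jt; case: eqP => [-> | /eqP pp'].
    exact: new_sound.
  have [lp pv'] := live' lp'; move=> Tw.
  apply: sound_ext (inv_sound inv lp st6 jt Tw) => // u ou.
  by rewrite /own' ou (negbTE pv').
- move=> q a fq /own'P[oa av]; case: eqP => [ap | /eqP ap].
    by rewrite ap; apply: new_closable => //; rewrite -ap.
  by rewrite terr'E //; exact: (inv_closable inv fq oa).
- move=> q a l fq /own'P[oa av] qa; case: eqP => [ap | /eqP ap].
    by rewrite ap; apply: (new_openable fq ap).
  by rewrite terr'E //; exact: (inv_openable inv fq oa qa).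
move=> q j fq; case: eqP => [np | /eqP np].
  have -> : terr own' n = U' by rewrite /U' -np.
  exact: new_root.
rewrite terr'E //; first exact: (inv_root inv fq).
by have := ltn_ord v; lia.
Qed.

End Tables.

(** * Transport and initial validity of the table invariants *)

Section TableInvariants.

Variables (n : nat) (e : rel 'I_n) (col : 'I_n -> bool) (t : nat).

(** Only in-range entries at live indices carry meaning, so the invariant passes between memories
    that agree on those. *)
Lemma dp_inv_ext own T T' L L' :
  (forall p st j, live own p -> st < 6 -> j <= t -> T' p st j = T p st j) ->
  (forall p st j u, live own p -> st < 6 -> j <= t -> L' p st j u = L p st j u) ->
  dp_inv e col t own T L -> dp_inv e col t own T' L'.
Proof.
move=> ET EL [o c s cl op ro].
have lv (v : 'I_n) : own v = v -> live own v by right; exists v.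
have Jt q U : feasible e col t q -> #|kept_classes e q U| <= t.
  by case=> _; apply/leq_trans/subset_leq_card/kept_classesS/subsetT.
split=> //.
- move=> p st j w lp st6 jt; rewrite ET // => Tw.
  by apply: sound_ext (s _ _ _ _ lp st6 jt Tw) => // u; rewrite EL.
- move=> q v fq ov; have [st [j [st6 K J]]] := cl q v fq ov.
  have := Jt q (terr own v) fq => jt.
  by exists st, j; rewrite ET //; [apply: lv | lia].
- move=> q v l fq ov ql cU; have [st [j [st6 K J cap]]] := op q v l fq ov ql cU.
  exists st, j; rewrite ET //; [exact: lv | by case/andP: st6 |].
  rewrite J; apply: leq_trans (Jt q (terr own v) fq).
  exact/subset_leq_card/subD1set.
by move=> q j fq Jj jt; rewrite ET //; [apply: ro | left].
Qed.

(** The state of a class with a single vertex: 3 if it is red, 1 if it is blue. *)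
Definition color_state (b : bool) : nat := 3 - 2 * b.

(** Territories are single vertices without edges; a vertex stays unlabeled or opens a class alone.
    The root starts with value zero at every [j], which is what makes [j] a budget there. *)
Lemma dp_inv_init (T : nat -> nat -> nat -> nat) (L : nat -> nat -> nat -> 'I_n -> nat) : symmetric e ->
  (forall (v : 'I_n) st j, st < 6 -> j <= t ->
     T v st j = (j == 0) && ((st == 0) || (st == color_state (col v)))) ->
  (forall st j, st < 6 -> j <= t -> T n st j = (st == 0)) ->
  (forall (v : 'I_n) st u, st < 6 ->
     L v st 0 u = [&& st != 0, st == color_state (col v) & u == v]) ->
  (forall j u, j <= t -> L n 0 j u = 0) ->
  dp_inv e col t (@nat_of_ord n) T L.
Proof.
move=> sym Tv Tn Lv Ln.
have ncol0 L0 b l : (forall u, L0 u = 0) -> 0 < l -> ncol col L0 b l = 0.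
  move=> z l0; apply/eqP; rewrite cards_eq0; apply/eqP/setP=> u.
  by rewrite !inE z (ltn_eqF l0) andbF.
have sound0 p j L0 : (forall u, L0 u = 0) -> sound e col (@nat_of_ord n) p 0 j 0 L0.
  move=> z; split=> // [u | u | l b l1 | b]; rewrite ?z //.
    by rewrite ncol0 //; lia.
  by rewrite ncol0.
have terrv (v : 'I_n) : terr (@nat_of_ord n) v = [set v].
  by apply/setP=> u; rewrite !inE val_eqE.
have kept1 q (v : 'I_n) : kept e q [set v] = set0.
  apply/setP=> -[x y]; rewrite !inE /=; apply/negP.
  by case/andP=> /and4P[xy _ /eqP h1 /eqP h2]; rewrite h1 h2 ltnn in xy.
have keptc0 q U : kept e q U = set0 -> kept_classes e q U = set0.
  move=> z; apply/setP=> l; rewrite in_set0 inE z; apply/existsP=> -[x].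
  by rewrite inE.
have st6 b : 0 < color_state b < 6 by case: b.
split.
- by move=> u; right; exists u.
- by [].
- move=> p st j w lp s6 jt; case: lp => [->|[v -> _]].
    by rewrite Tn //; case: eqP => // -> [<-]; apply: sound0 => u; rewrite Ln.
  rewrite Tv //; case: eqP => //= ->; case: eqP => [->|s0] /=.
    by case=> <-; apply: sound0 => u; rewrite Lv.
  case: eqP => // sc [<-].
  have LE u : L v st 0 u = (u == v) by rewrite Lv // (introF eqP s0) sc eqxx.
  split=> //.
  + by move=> u; rewrite LE; case: (eqVneq u v) => [->|].
  + by move=> u; rewrite LE; case: (u == v).
  + move=> l b l1; suff -> : ncol col (L v st 0) b l = 0 by [].
    apply/eqP; rewrite cards_eq0; apply/eqP/setP=> u; rewrite !inE LE.
    by rewrite ltn_eqF ?andbF //; apply: leq_ltn_trans l1; case: (u == v).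
  + move=> b; have [cb | cb] := eqVneq (col v) b.
      apply: (@leq_trans #|[set v]|).
        apply/subset_leq_card/subsetP=> u; rewrite !inE LE.
        by case: (u == v); rewrite ?andbF.
      by rewrite cards1 sc cb; case: b {cb}.
    suff -> : ncol col (L v st 0) b 1 = 0 by [].
    apply/eqP; rewrite cards_eq0; apply/eqP/setP=> u; rewrite !inE LE.
    by have [->|] := eqVneq u v; rewrite ?(negbTE cb) ?andbF.
  by exists v => //; rewrite LE eqxx.
- move=> q v fq _; rewrite terrv; exists 0, 0.
  by rewrite kept1 keptc0 ?kept1 // !cards0 Tv.
- move=> q v l fq _ ql _; rewrite terrv; exists (color_state (col v)), 0.
  rewrite kept1 keptc0 ?kept1 // set0D !cards0; split=> //.
    by rewrite Tv ?eqxx ?orbT //; case/andP: (st6 (col v)).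
  move=> b; have [cb | cb] := eqVneq (col v) b; last by case: b (col v) cb => -[].
  apply: (@leq_trans 1); first by rewrite cb; case: (b).
  by apply/card_gt0P; exists v; rewrite !inE ql cb !eqxx.
move=> q j fq _ jt; rewrite Tn //.
suff -> : kept e q (terr (@nat_of_ord n) n) = set0 by rewrite cards0.
apply/setP=> -[x y]; rewrite !inE /=; apply/negP => /andP[/and4P[_ _ /eqP h _] _].
by have := ltn_ord x; rewrite h ltnn.
Qed.

Lemma own_merge_fixed (own : 'I_n -> nat) (p : nat) (v u : 'I_n) :
  live own p -> own v = v -> p != v :> nat ->
  ((if own u == v then p else own u) == u) = (own u == u) && (u != v).
Proof.
move=> lp ov pv; have [ouv|ouv] := eqVneq (own u) v.
  rewrite ouv [(v : nat) == u]eq_sym val_eqE andbN; apply/eqP=> pu.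
  case: lp => [pn|[w pw ow]]; first by have := ltn_ord u; lia.
  have wu : w = u by apply: val_inj; rewrite /= -pw pu.
  by move: pv; rewrite pu -wu -ow wu ouv eqxx.
case: (eqVneq (own u) u) => //= ou; symmetry; apply/eqP=> uv.
by rewrite uv ov eqxx in ouv.
Qed.

End TableInvariants.

(** * Cost of fair clusterings *)

Lemma card_by_label (T J : finType) (A : {set T}) (g : T -> J) :
  #|A| = \sum_(l : J) #|[set x in A | g x == l]|.
Proof.
rewrite -sum1_card (partition_big g xpredT) //=; apply: eq_bigr => l _.
by rewrite -sum1_card; apply: eq_bigl => x; rewrite inE.
Qed.

(** * Clusters indexed by representatives *)

Section Representatives.

Variables (n : nat) (p : 'I_n -> nat).

(** Labels are arbitrary naturals; a representative indexes the clusters by a finite type. [pick]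
    depends only on the values of its predicate, so equal labels give the same vertex. *)
Definition rep (u : 'I_n) : 'I_n := odflt u [pick v | p v == p u].

Lemma rep_eq u v : (rep u == rep v) = (p u == p v).
Proof.
have pr w : p (rep w) = p w by rewrite /rep; case: pickP => [z /eqP|].
apply/eqP/eqP => [E | E]; first by rewrite -(pr u) E pr.
rewrite /rep; under eq_pick do rewrite E.
by case: pickP => // /(_ v); rewrite eqxx.
Qed.

Definition rep_class (l : 'I_n) : {set 'I_n} := [set u | rep u == l].

Lemma rep_class_cluster u : rep_class (rep u) = cluster p u.
Proof. by apply/setP=> v; rewrite !inE rep_eq. Qed.

Lemma rep_class_cases l : rep_class l = set0 \/ exists u, rep_class l = cluster p u.
Proof.
have [->|/set0Pn[u]] := eqVneq (rep_class l) set0; first by left.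
by rewrite inE => /eqP <-; right; exists u; rewrite rep_class_cluster.
Qed.

Definition same_pairs : {set 'I_n * 'I_n} :=
  [set x : 'I_n * 'I_n | (x.1 < x.2) && (p x.1 == p x.2)].

Definition same_edges (e : rel 'I_n) : {set 'I_n * 'I_n} :=
  [set x : 'I_n * 'I_n | [&& x.1 < x.2, e x.1 x.2 & p x.1 == p x.2]].

Lemma cost_same e :
  cost e p + 2 * #|same_edges e| = #|edges_in e setT| + #|same_pairs|.
Proof.
pose A := [set x : 'I_n * 'I_n | [&& x.1 < x.2, ~~ e x.1 x.2 & p x.1 == p x.2]].
pose B := [set x : 'I_n * 'I_n | [&& x.1 < x.2, e x.1 x.2 & p x.1 != p x.2]].
have cAB : cost e p = #|A| + #|B|.
  rewrite /cost -(cardsID A); congr (_ + _); apply: eq_card => x; rewrite !inE;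
  by case: (_ < _); case: (e _ _); case: (_ == _).
have cE : #|edges_in e setT| = #|same_edges e| + #|B|.
  rewrite -(cardsID (same_edges e) (edges_in e setT)); congr (_ + _); apply: eq_card => x; rewrite !inE;
  by case: (_ < _); case: (e _ _); case: (_ == _).
have cP : #|same_pairs| = #|same_edges e| + #|A|.
  rewrite -(cardsID (same_edges e) same_pairs); congr (_ + _); apply: eq_card => x; rewrite !inE;
  by case: (_ < _); case: (e _ _); case: (_ == _).
by rewrite cAB cE cP; move: #|A| #|B| #|same_edges e| => a b c; lia.
Qed.

Lemma card_same_pairs : #|same_pairs| = \sum_l #|pairs_in (rep_class l)|.
Proof.
rewrite (card_by_label _ (fun x => rep x.1)); apply: eq_bigr => l _.
apply: eq_card => x; rewrite !inE -rep_eq.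
by case: (_ < _) => //=; case: (eqVneq (rep x.1) l) => [<-|_]; rewrite ?andbF ?andbT //= eq_sym.
Qed.

Lemma card_same_edges e : #|same_edges e| = \sum_l #|edges_in e (rep_class l)|.
Proof.
rewrite (card_by_label _ (fun x => rep x.1)); apply: eq_bigr => l _.
apply: eq_card => x; rewrite !inE -rep_eq.
by case: (_ < _) => //=; case: (eqVneq (rep x.1) l) => [<-|_]; rewrite ?andbF ?andbT //= eq_sym.
Qed.

Lemma card_rep_class : n = \sum_l #|rep_class l|.
Proof.
rewrite -{1}(card_ord n) -cardsT (card_by_label _ rep); apply: eq_bigr => l _.
by apply: eq_card => x; rewrite !inE.
Qed.

End Representatives.

Section FairClusterings.

Variables (n : nat) (e : rel 'I_n) (col : 'I_n -> bool) (t : nat).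
Hypotheses (simple_e : simple_graph e) (forest_e : forest e).
Hypotheses (t0 : 0 < t) (n3t : n = 3 * t).
Hypothesis color_card : forall b, #|color_class col b| = t * b.+1.

(** Cancelling [t] turns fairness into the ratio 1 : 2 inside [S]; for red this shows that sizes of
    fair sets are multiples of three. *)
Lemma fair_count S b : fair_set col S -> 3 * color_count col b S = b.+1 * #|S|.
Proof.
move=> /(_ b); rewrite color_card.
have -> : #|S :&: color_class col b| = color_count col b S.
  by apply: eq_card => u; rewrite !inE.
move: (color_count _ _ _) #|S| => c s H; apply/eqP; rewrite -(eqn_pmul2l t0).
by apply/eqP; rewrite [RHS]mulnA -H mulnA mulnC n3t [t * 3]mulnC.
Qed.

Lemma fair_class_count p l b : fair_clustering col p ->
  3 * color_count col b (rep_class p l) = b.+1 * #|rep_class p l|.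
Proof.
move=> fp; case: (rep_class_cases p l) => [->|[u ->]]; last exact: fair_count.
rewrite cards0 muln0; apply/eqP; rewrite muln_eq0 /= cards_eq0.
by apply/eqP/setP=> u; rewrite !inE.
Qed.

Section Relax.

Variable p : 'I_n -> nat.
Hypothesis fair_p : fair_clustering col p.

Let S l := rep_class p l.

Let chosen (l : 'I_n) := [pick x in edges_in e (S l) | col x.1 || col x.2].

(* Clusters of size three survive; in a cluster of size six a single edge is kept,
   which makes up for the case of five edges; larger clusters are dissolved. *)
Let relax (u : 'I_n) : option 'I_n :=
  let l := rep p u in
  if #|S l| == 3 then Some l
  else if chosen l is Some x then
    if (#|S l| == 6) && ((u == x.1) || (u == x.2)) then Some l else None
  else None.

Let relax_rep u l : relax u = Some l -> rep p u = l.
Proof.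
rewrite /relax; case: ifP => [_ [] //|_]; case: (chosen _) => // x.
by case: ifP => // _ [].
Qed.

Let relax_cap l b : color_count col b (class_of relax l) <= b.+1.
Proof.
have k3 := fair_class_count l b fair_p; rewrite -/(S l) in k3.
have sub : class_of relax l \subset S l.
  by apply/subsetP=> u; rewrite !inE => /eqP/relax_rep ->.
have [E3|N3] := eqVneq #|S l| 3.
  apply: (@leq_trans (color_count col b (S l))); last by rewrite E3 in k3; lia.
  apply/subset_leq_card/subsetP=> u; rewrite !inE => /andP[/eqP/relax_rep <-] ->.
  by rewrite eqxx.
rewrite /color_count; case C: (chosen l) => [x|]; last first.
  suff -> : [set u in class_of relax l | col u == b] = set0 by rewrite cards0.
  apply/setP=> u; rewrite !inE; apply/negP=> /andP[/eqP ql _].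
  by have := relax_rep ql; move: ql; rewrite /relax => /[swap] ->; rewrite (negbTE N3) C.
have xcol : col x.1 || col x.2.
  by move: C; rewrite /chosen; case: pickP => // y /andP[_ h] [<-].
have subx : class_of relax l \subset [set x.1; x.2].
  apply/subsetP=> u; rewrite !inE => /eqP ql.
  have := relax_rep ql; move: ql; rewrite /relax => /[swap] ->; rewrite (negbTE N3) C.
  by case: ifP => // /andP[].
(* Two endpoints never exceed the blue capacity. For red, the chosen edge has a blue endpoint, so
   only the other one can be red. *)
case: b k3 => _ /=.
  apply: leq_trans (subset_leq_card _) (_ : #|[set x.1; x.2]| <= 2).
    by apply: subset_trans subx; apply/subsetP=> u; rewrite !inE => /andP[].
  by rewrite cards2; case: eqP.
suff [y sy] : exists y, [set u in class_of relax l | col u == false] \subset [set y].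
  by rewrite (leq_trans (subset_leq_card sy)) ?cards1.
exists (if col x.1 then x.2 else x.1); apply/subsetP=> u.
rewrite inE => /andP[/(subsetP subx)]; rewrite !inE => h /eqP cu.
case/orP: h cu => /eqP -> cu; first by rewrite cu eqxx.
by move: xcol; rewrite cu orbF => ->; rewrite eqxx.
Qed.

(** Each kept class lies in its own nonempty cluster, whose size is a positive multiple of three. *)
Let relax_kept_classes : 3 * #|kept_classes e relax setT| <= n.
Proof.
rewrite [X in _ <= X](card_rep_class p) (bigID (mem (kept_classes e relax setT))) /=.
apply: leq_trans (leq_addr _ _); rewrite mulnC -sum_nat_const; apply: leq_sum => l.
case/kept_classesP=> x [y [_ _ _ _ [qx _]]].
have k3 := fair_class_count l false fair_p; rewrite -/(S l) in k3 *.
have : 0 < #|S l| by apply/card_gt0P; exists x; rewrite inE (relax_rep qx).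
by move: k3; rewrite -/(S l); move: #|S l| (color_count _ _ _) => k c; lia.
Qed.

Lemma relax_feasible : feasible e col t relax.
Proof. by split; [exact: relax_cap | move: relax_kept_classes; lia]. Qed.

(** [#|S l|] is the number of pairs inside triples formed from these vertices, so this is the cost
    comparison restricted to one cluster. *)
Let relax_class l (a := #|[set x in kept e relax setT | rep p x.1 == l]|) :
  #|S l| + 2 * #|edges_in e (S l)| <= #|pairs_in (S l)| + 2 * a.
Proof.
have k3 := fair_class_count l false fair_p; rewrite -/(S l) in k3.
have m := card_edges_in simple_e forest_e (S l).
have pr := card_pairs_in (S l).
have [E3|N3] := eqVneq #|S l| 3.
  have : #|edges_in e (S l)| <= a.
    apply/subset_leq_card/subsetP=> x; rewrite !inE.
    case/and4P=> -> -> /eqP r1 /eqP r2; rewrite /relax r1 r2 E3 !eqxx //.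
  by rewrite E3 in m pr *; lia.
have [E6|N6] := eqVneq #|S l| 6; last first.
  move: k3 m pr N3 N6; move: #|S l| #|edges_in _ _| #|pairs_in _| (color_count _ _ _).
  move=> k m' pr' c Ek Hm Hpr n3 n6.
  (* With no kept edge, what is needed at worst is k + 2(k-1) <= k(k-1)/2, which holds for
     [9 <= k]. *)
  have [k0|k9] : k = 0 \/ 9 <= k by lia.
    by rewrite k0 in Hm *; lia.
  nia.
rewrite E6 in m pr *.
case C: (chosen l) => [x|].
  suff : 0 < a by lia.
  move: (C); rewrite /chosen; case: pickP => // y /andP[yE _] [Ey]; subst y.
  move: yE; rewrite inE => /and4P[x12 ex r1 r2].
  apply/card_gt0P; exists x; move: r1 r2; rewrite !inE x12 ex => /eqP r1 /eqP r2.
  by rewrite /relax r1 r2 E6 C /= !eqxx orbT /= eqxx.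
(* No edge touches a blue vertex, so all edges lie among the two red ones; there is at most one, and
   6 + 2 <= 15. *)
pose R := [set u in S l | col u == false].
have ER : edges_in e (S l) \subset edges_in e R.
  apply/subsetP=> x0 xE; have := C; rewrite /chosen; case: pickP => // /(_ x0).
  rewrite xE /= => /norP[c1 c2] _; move: xE; rewrite !inE => /and4P[-> -> -> ->].
  by rewrite (negbTE c1) (negbTE c2).
have := subset_leq_card ER; have := card_edges_in simple_e forest_e R.
have -> : #|R| = color_count col false (S l) by [].
by rewrite E6 in k3; lia.
Qed.

Lemma relax_bound :
  n + 2 * #|same_edges p e| <= #|same_pairs p| + 2 * #|kept e relax setT|.
Proof.
rewrite [X in X + _](card_rep_class p) card_same_edges card_same_pairs.
rewrite [#|kept _ _ _|](card_by_label _ (fun x => rep p x.1)).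
by rewrite !big_distrr /= -!big_split /=; apply: leq_sum => l _; apply: relax_class.
Qed.

Lemma exists_relaxation : exists2 q, feasible e col t q &
  n + 2 * #|same_edges p e| <= #|same_pairs p| + 2 * #|kept e q setT|.
Proof. by exists relax; [exact: relax_feasible | exact: relax_bound]. Qed.

End Relax.

(** The [t] classes have exactly as much room for each color as there are vertices of it, so every
    capacity is attained and every class is a fair triple. Such a clustering has [n] pairs inside
    clusters, the amount charged in [exists_relaxation], and only the kept edges remain to be
    compared. *)
Lemma full_labels_min (p : 'I_n -> nat) :
  (forall u, 1 < p u <= t.+1) -> (forall l b, 1 < l -> ncol col p b l <= b.+1) ->
  (forall q, feasible e col t q -> #|kept e q setT| <= #|intra e p|) ->
  min_cost_fair_clustering e col p.
Proof.
move=> plab pcap pmax.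
have full u b : ncol col p b (p u) = b.+1.
  have sum : t * b.+1 = \sum_(l < t) ncol col p b l.+2.
    rewrite -color_card.
    have [f fE] : exists f : 'I_n -> 'I_t, forall u, p u = (f u).+2.
      have lt w : p w - 2 < t by have := plab w; lia.
      by exists (fun w => Ordinal (lt w)) => w /=; have := plab w; lia.
    rewrite (card_by_label _ f); apply: eq_bigr => l _; apply: eq_card => w.
    by rewrite !inE fE -val_eqE.
  have lt : p u - 2 < t by have := plab u; lia.
  move: sum; rewrite (bigD1 (Ordinal lt)) //=.
  have -> : (p u - 2).+2 = p u by have := plab u; lia.
  have : \sum_(l < t | l != Ordinal lt) ncol col p b l.+2 <= (t - 1) * b.+1.
    have -> : (t - 1) * b.+1 = \sum_(l < t | l != Ordinal lt) b.+1.
      by rewrite sum_nat_const -[X in X - 1](card_ord t) (cardC1 (Ordinal lt)) subn1.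
    by apply: leq_sum => l _; apply: pcap.
  have : ncol col p b (p u) <= b.+1 by apply: pcap; have /andP[] := plab u.
  have -> : t * b.+1 = b.+1 + (t - 1) * b.+1 by rewrite -mulSn subn1 prednK.
  move: (\sum_(l < t | _) _) ((t - 1) * b.+1) (ncol _ _ _ _) => x y z; lia.
have clE b u : #|cluster p u :&: color_class col b| = b.+1.
  by rewrite -(full u b); apply: eq_card => w; rewrite !inE andbC.
have cl3 u : #|cluster p u| = 3.
  rewrite -(cardsID (color_class col true)) clE -(clE false u).
  by congr (_ + _); apply: eq_card => w; rewrite !inE; case: (col w); rewrite ?andbF ?andbT.
have fair_p : fair_clustering col p.
  by move=> u b; rewrite clE cl3 color_card n3t; lia.
split=> // q fq; have [q0 fq0 bound] := exists_relaxation fq.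
have pairs_p : #|same_pairs p| = n.
  rewrite card_same_pairs [RHS](card_rep_class p); apply: eq_bigr => l _.
  have := card_pairs_in (rep_class p l).
  by case: (rep_class_cases p l) => [->|[u ->]]; rewrite ?cards0 ?cl3; lia.
have edges_p : #|same_edges p e| = #|intra e p|.
  apply: eq_card => x; rewrite !inE; have -> : p x.1 != 0 by have := plab x.1; lia.
  by rewrite andbT.
have := cost_same p e; have := cost_same q e; have := pmax _ fq0.
by rewrite edges_p pairs_p; move: bound; lia.
Qed.

End FairClusterings.

(** * Evaluation of expressions and frames *)

(** Evaluation without the word bound, so that overflow is treated once and for all in
    [aeval_den]. *)
Fixpoint den (s : state) (a : aexp) : nat :=
  match a with
  | ANum k => k
  | AVar x => vars s x
  | AAdd a1 a2 => den s a1 + den s a2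
  | ASub a1 a2 => den s a1 - den s a2
  | AMul a1 a2 => den s a1 * den s a2
  | ADiv a1 a2 => den s a1 %/ den s a2
  | AMod a1 a2 => den s a1 %% den s a2
  | ALt a1 a2 => den s a1 < den s a2
  | AEq a1 a2 => den s a1 == den s a2
  | ALoad arr i => Defs.mem s arr (den s i)
  end.

Fixpoint leaves (a : aexp) : nat :=
  match a with
  | ANum _ | AVar _ => 1
  | AAdd a1 a2 | ASub a1 a2 | AMul a1 a2 | ADiv a1 a2 | AMod a1 a2
  | ALt a1 a2 | AEq a1 a2 => leaves a1 + leaves a2
  | ALoad _ i => leaves i
  end.

Fixpoint consts_le (B : nat) (a : aexp) : bool :=
  match a with
  | ANum k => k <= B
  | AVar _ => true
  | AAdd a1 a2 | ASub a1 a2 | AMul a1 a2 | ADiv a1 a2 | AMod a1 a2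
  | ALt a1 a2 | AEq a1 a2 => consts_le B a1 && consts_le B a2
  | ALoad _ i => consts_le B i
  end.

Definition small_aexp (a : aexp) : bool := (leaves a <= 60) && consts_le 100 a.

Fixpoint mvars (c : cmd) : seq nat :=
  match c with
  | CSkip | CStore _ _ _ => [::]
  | CAssign x _ => [:: x]
  | CSeq c1 c2 | CIf _ c1 c2 => mvars c1 ++ mvars c2
  | CWhile _ c => mvars c
  end.

Fixpoint marrs (c : cmd) : seq nat :=
  match c with
  | CSkip | CAssign _ _ => [::]
  | CStore a _ _ => [:: a]
  | CSeq c1 c2 | CIf _ c1 c2 => marrs c1 ++ marrs c2
  | CWhile _ c => marrs c
  end.

Definition frame (c : cmd) (s s' : state) : Prop :=
  (forall x, x \notin mvars c -> vars s' x = vars s x) /\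
  (forall a i, a \notin marrs c -> Defs.mem s' a i = Defs.mem s a i).

Lemma frame_trans c s1 s2 s3 : frame c s1 s2 -> frame c s2 s3 -> frame c s1 s3.
Proof.
move=> [v12 m12] [v23 m23]; split=> [x xc | a i ac].
  by rewrite v23 ?v12.
by rewrite m23 ?m12.
Qed.

Lemma frame_sub c c' s s' :
  {subset mvars c <= mvars c'} -> {subset marrs c <= marrs c'} ->
  frame c s s' -> frame c' s s'.
Proof.
move=> sv sm [v m]; split=> [x | a i] nc.
  by apply: v; apply: contra nc; apply: sv.
by apply: m; apply: contra nc; apply: sm.
Qed.

Lemma exec_frame W c s k s' : exec W c s k s' -> frame c s s'.
Proof.
elim=> {c s k s'} //=.
- by move=> s x a v _; split=> //= y; rewrite inE => /negbTE ->.
- by move=> s arr ai av i v _ _; split=> //= a j; rewrite inE => /negbTE ->.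
- move=> c1 c2 s1 s2 s3 k1 k2 _ f1 _ f2.
  by apply: frame_trans (frame_sub _ _ f1) (frame_sub _ _ f2) => x /= xc;
    rewrite mem_cat xc ?orbT.
- by move=> b c1 c2 s s' v k _ _ _; apply: frame_sub => x /= xc; rewrite mem_cat xc.
- by move=> b c1 c2 s s' k _ _; apply: frame_sub => x /= xc; rewrite mem_cat xc orbT.
- by move=> b c s1 s2 s3 v k1 k2 _ _ _ f1 _ f2; apply: frame_trans f1 f2.
Qed.

Definition bounded (M : nat) (s : state) : Prop :=
  (forall x, vars s x <= M) /\ (forall a i, Defs.mem s a i <= M).

(** * The program *)

Definition CFor (x : nat) (b : aexp) (body : cmd) : cmd :=
  CSeq (CAssign x (ANum 0))
    (CWhile (ALt (AVar x) b)
       (CSeq body (CAssign x (AAdd (AVar x) (ANum 1))))).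

Declare Scope aexp_scope.
Delimit Scope aexp_scope with A.
Bind Scope aexp_scope with aexp.
Notation "x + y" := (AAdd x y) : aexp_scope.
Notation "x - y" := (ASub x y) : aexp_scope.
Notation "x * y" := (AMul x y) : aexp_scope.
Notation "x %/ y" := (ADiv x y) : aexp_scope.
Notation "x %% y" := (AMod x y) : aexp_scope.
Notation "x < y" := (ALt x y) : aexp_scope.
Notation "x == y" := (AEq x y) : aexp_scope.
Notation "'V' x" := (AVar x) (at level 9, x at level 8) : aexp_scope.
Notation "'K' x" := (ANum x) (at level 9, x at level 8) : aexp_scope.
Notation "a '@' i" := (ALoad a i) (at level 9, i at level 8) : aexp_scope.
Notation "x '<-' a" := (CAssign x a%A) (at level 90) : cmd_scope.
Notation "c1 ;; c2" := (CSeq c1 c2) (at level 95, right associativity) : cmd_scope.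
Delimit Scope cmd_scope with C.
Bind Scope cmd_scope with cmd.

(* A table entry is addressed by table number, state and number of closed classes;
   the labelling stored with it occupies a block of n cells. *)
Definition adT (n id st j : nat) : nat := (id * 6 + st) * (n + 1) + j.
Definition adL (n id st j u : nat) : nat := adT n id st j * n + u.

Definition aT (id st j : aexp) : aexp := ((id * K 6 + st) * (V 0 + K 1) + j)%A.
Definition aL (id st j u : aexp) : aexp := (aT id st j * V 0 + u)%A.

Arguments aT : simpl never.
Arguments aL : simpl never.

Lemma den_aT s id st j :
  den s (aT id st j) = adT (vars s 0) (den s id) (den s st) (den s j).
Proof. by []. Qed.

Lemma den_aL s id st j u :
  den s (aL id st j u) = adL (vars s 0) (den s id) (den s st) (den s j) (den s u).
Proof. by []. Qed.

Lemma eq_muladd d a b a' b' : b < d -> b' < d ->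
  (a * d + b == a' * d + b') = (a == a') && (b == b').
Proof.
move=> bd bd'; apply/eqP/andP => [E | [/eqP -> /eqP ->] //].
have d0 : 0 < d by lia.
have := congr1 (modn^~ d) E; have := congr1 (divn^~ d) E.
by rewrite /= !divnMDl // !modnMDl !divn_small // !modn_small // !addn0 => -> ->.
Qed.

Lemma eq_adT n id st j id' st' j' : st < 6 -> st' < 6 -> j <= n -> j' <= n ->
  (adT n id st j == adT n id' st' j') = [&& id == id', st == st' & j == j'].
Proof. by move=> *; rewrite /adT !eq_muladd ?andbA //; lia. Qed.

Lemma eq_adL n id st j u id' st' j' u' :
  st < 6 -> st' < 6 -> j <= n -> j' <= n -> u < n -> u' < n ->
  (adL n id st j u == adL n id' st' j' u') = [&& id == id', st == st', j == j' & u == u'].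
Proof. by move=> *; rewrite /adL eq_muladd // eq_adT // !andbA. Qed.

(* Variables: 0 = n, 1 = t, 2 = round, 3 = leaf, 4 = its neighbour (or n), 5.. = temporaries.
   Arrays: 0 = adjacency, 1 = colors, 2 = output, 3 = removed, 4 = tables,
   5 = labellings, 6 = current table of a vertex (index n: the dummy root). *)
Definition init_prog : cmd := (
  1 <- V 0 %/ K 3 ;;
  CFor 3 (V 0) (
    CStore 6 (V 3) (V 3) ;;
    CStore 4 (aT (V 3) (K 0) (K 0)) (K 1) ;;
    CStore 4 (aT (V 3) (K 3 - K 2 * 1@(V 3)) (K 0)) (K 1) ;;
    CStore 5 (aL (V 3) (K 3 - K 2 * 1@(V 3)) (K 0) (V 3)) (K 1)) ;;
  CStore 6 (V 0) (V 0) ;;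
  CFor 6 (V 1 + K 1) (CStore 4 (aT (V 0) (K 0) (V 6)) (K 1)))%C.

Definition leaf_prog : cmd := (
  CFor 5 (V 0) (
    CIf (3@(V 5) == K 0) (
      7 <- K 0 ;;
      8 <- V 0 ;;
      CFor 6 (V 0) (
        CIf ((3@(V 6) == K 0) * 0@(V 5 * V 0 + V 6))
          (7 <- V 7 + K 1 ;; 8 <- V 6) CSkip) ;;
      CIf (V 7 < K 2) (3 <- V 5 ;; 4 <- V 8) CSkip)
    CSkip))%C.

(** Indices 0 to [n] hold the initial tables. Each round writes to a fresh index, so the two tables
    it reads stay intact. *)
Definition new_id : aexp := (V 0 + K 1 + V 2)%A.

(** The counter is read in mixed radix 2, 6, 6, [t + 1], [t + 1]: the choice of [m], two states and
    two class counts. This is the origin of the factor 72 = 2 * 6 * 6. *)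
Definition decode_prog : cmd := (
  10 <- V 9 %% K 2 ;;
  11 <- (V 9 %/ K 2) %% K 6 ;;
  12 <- (V 9 %/ K 12) %% K 6 ;;
  13 <- (V 9 %/ K 72) %% (V 1 + K 1) ;;
  14 <- (V 9 %/ K 72) %/ (V 1 + K 1) ;;
  15 <- 4@(aT 6@(V 4) (V 11) (V 13)) ;;
  16 <- 4@(aT 6@(V 3) (V 12) (V 14)) ;;
  17 <- V 11 + V 10 * V 12 ;;
  18 <- V 13 + V 14 + (K 1 - V 10) * (K 0 < V 12))%C.

Definition new_value : aexp := (V 15 + V 16 + V 10 - K 1)%A.

(** Products of 0/1 values act as conjunction, the sum as disjunction. The comparison of [new_value]
    with [n + 1] keeps stored values bounded without any appeal to the meaning of the tables. *)
Definition improves : aexp := (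
  (K 0 < V 15) * (K 0 < V 16) * (V 18 < V 1 + K 1) * (new_value < V 0 + K 1)
  * ((V 10 == K 0) + (K 0 < V 11) * (K 0 < V 12)
       * (V 11 %/ K 3 + V 12 %/ K 3 < K 2) * (V 11 %% K 3 + V 12 %% K 3 < K 3))
  * (4@(aT new_id (V 17) (V 18)) < new_value))%A.

Definition copy_labels_prog : cmd :=
  CFor 5 (V 0)
    (CStore 5 (aL new_id (V 17) (V 18) (V 5))
       (5@(aL 6@(V 4) (V 11) (V 13) (V 5))
        + (5@(aL 6@(V 3) (V 12) (V 14) (V 5)) == K 1)
            * (V 10 + (K 1 - V 10) * (V 18 + K 1))
        + (K 1 < 5@(aL 6@(V 3) (V 12) (V 14) (V 5)))
            * (5@(aL 6@(V 3) (V 12) (V 14) (V 5)) + V 13))).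

Definition merge_body : cmd := (
  decode_prog ;;
  CIf improves
    (CStore 4 (aT new_id (V 17) (V 18)) new_value ;; copy_labels_prog)
    CSkip)%C.

Definition merge_prog : cmd :=
  CFor 9 (K 72 * ((V 1 + K 1) * (V 1 + K 1))) merge_body.

Definition rounds_prog : cmd :=
  CFor 2 (V 0) (
    leaf_prog ;;
    merge_prog ;;
    CStore 3 (V 3) (K 1) ;;
    CStore 6 (V 4) new_id)%C.

Definition fill_prog : cmd := (
  CFor 5 (V 0) (CStore 2 (V 5) 5@(aL 6@(V 0) (K 0) (V 1) (V 5))) ;;
  CFor 5 (V 0) (
    CFor 6 (V 1) (
      7 <- K 0 ;;
      CFor 9 (V 0) (
        CIf ((2@(V 9) == V 6 + K 2) * (1@(V 9) == 1@(V 5))) (7 <- V 7 + K 1) CSkip) ;;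
      CIf ((V 7 < K 1 + 1@(V 5)) * (2@(V 5) == K 0)) (CStore 2 (V 5) (V 6 + K 2)) CSkip)))%C.

Definition clustering_prog : cmd := (init_prog ;; rounds_prog ;; fill_prog)%C.

Lemma card_ltnS n i (P : pred 'I_n) (lt : i < n) :
  #|[set w : 'I_n | (w < i.+1) && P w]| = #|[set w : 'I_n | (w < i) && P w]| + P (Ordinal lt).
Proof.
rewrite (cardsD1 (Ordinal lt)) addnC inE /= ltnSn; congr (_ + _).
apply: eq_card => w; rewrite !inE -val_eqE /= ltnS [w <= i]leq_eqVlt.
by case: eqVneq => [->|] //=; rewrite ltnn.
Qed.

(** * Total correctness with step counts *)

Section Programs.

Variables W M : nat.
Hypotheses (M_ge100 : 100 <= M) (M_lt_W : forall d, d <= 60 -> M ^ d < W).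

Lemma leaves_gt0 a : 0 < leaves a.
Proof. by elim: a => //= a1 l1 a2 l2; rewrite addn_gt0 l1. Qed.

Lemma den_le s a : bounded M s -> consts_le 100 a -> den s a <= M ^ leaves a.
Proof.
move=> [bv bm].
have M1 : 1 < M by lia.
have mono a1 a2 x : x <= M ^ leaves a1 -> x <= M ^ (leaves a1 + leaves a2).
  by move=> h; apply: leq_trans h _; rewrite leq_exp2l // leq_addr.
have ge1 a1 a2 x : x <= 1 -> x <= M ^ (leaves a1 + leaves a2).
  by move=> h; apply: leq_trans h _; rewrite expn_gt0; lia.
(* Two numbers that are at least 2 have a sum at most their product, so addition obeys the same
   bound as multiplication. *)
have ge2 a1 : 1 < M ^ leaves a1.
  by have := leaves_gt0 a1; rewrite -(ltn_exp2l _ _ M1) expn0.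
elim: a => //=.
- by move=> k h; lia.
- move=> a1 h1 a2 h2 /andP[/h1 {}h1 /h2 {}h2]; rewrite expnD.
  have := ge2 a1; have := ge2 a2; nia.
- by move=> a1 h1 a2 h2 /andP[/h1 {}h1 _]; apply: mono; lia.
- by move=> a1 h1 a2 h2 /andP[/h1 {}h1 /h2 {}h2]; rewrite expnD leq_mul.
- move=> a1 h1 a2 h2 /andP[/h1 {}h1 _]; apply: mono.
  by apply: leq_trans (leq_div _ _) h1.
- move=> a1 h1 a2 h2 /andP[/h1 {}h1 _]; apply: mono.
  by apply: leq_trans (leq_mod _ _) h1.
- by move=> a1 h1 a2 h2 _; apply: ge1; apply: leq_b1.
- by move=> a1 h1 a2 h2 _; apply: ge1; apply: leq_b1.
move=> arr a ha c; apply: leq_trans (bm _ _) _.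
by rewrite -[X in X <= _]expn1 leq_exp2l ?leaves_gt0.
Qed.

Lemma aeval_den s a : bounded M s -> small_aexp a -> aeval W s a = Some (den s a).
Proof.
move=> bs /andP[la ca].
have ltW b : leaves b <= 60 -> consts_le 100 b -> den s b < W.
  by move=> lb cb; apply: leq_ltn_trans (den_le bs cb) (M_lt_W lb).
have chkE b x : den s b = x -> leaves b <= 60 -> consts_le 100 b -> chk W x = Some x.
  by move=> <- lb cb; rewrite /chk ltW.
elim: a la ca => //=.
- by move=> k _ kc; rewrite (chkE (ANum k)).
- by move=> x _ _; rewrite (chkE (AVar x)).
- move=> a1 h1 a2 h2 l c; case/andP: (c) => c1 c2.
  by rewrite h1 ?h2 ?(chkE (AAdd a1 a2)) //; lia.
- move=> a1 h1 a2 h2 l c; case/andP: (c) => c1 c2.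
  by rewrite h1 ?h2 ?(chkE (ASub a1 a2)) //; lia.
- move=> a1 h1 a2 h2 l c; case/andP: (c) => c1 c2.
  by rewrite h1 ?h2 ?(chkE (AMul a1 a2)) //; lia.
- move=> a1 h1 a2 h2 l c; case/andP: (c) => c1 c2.
  by rewrite h1 ?h2 ?(chkE (ADiv a1 a2)) //; lia.
- move=> a1 h1 a2 h2 l c; case/andP: (c) => c1 c2.
  by rewrite h1 ?h2 ?(chkE (AMod a1 a2)) //; lia.
- move=> a1 h1 a2 h2 l c; case/andP: (c) => c1 c2.
  by rewrite h1 ?h2 ?(chkE (ALt a1 a2)) //; lia.
- move=> a1 h1 a2 h2 l c; case/andP: (c) => c1 c2.
  by rewrite h1 ?h2 ?(chkE (AEq a1 a2)) //; lia.
by move=> arr a h l c; rewrite h // (chkE (ALoad arr a)).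
Qed.

(** A total-correctness triple with a step bound. Boundedness by [M] is built into the
    postcondition, so that the next expression can again be evaluated without overflow. *)
Definition tr (c : cmd) (k : nat) (s : state) (Q : state -> Prop) : Prop :=
  exists k' s', [/\ exec W c s k' s', k' <= k, bounded M s' & Q s'].

Lemma tr_conseq c k k' s (Q Q' : state -> Prop) :
  tr c k' s Q' -> k' <= k ->
  (forall s', bounded M s' -> frame c s s' -> Q' s' -> Q s') -> tr c k s Q.
Proof.
move=> [k1 [s1 [ex le b q]]] lek imp; exists k1, s1; split=> //; first lia.
exact: imp (exec_frame ex) q.
Qed.

Lemma tr_skip s (Q : state -> Prop) : bounded M s -> Q s -> tr CSkip 1 s Q.
Proof. by move=> b q; exists 1, s; split=> //; constructor. Qed.

Lemma tr_assign x a s (Q : state -> Prop) :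
  bounded M s -> small_aexp a -> den s a <= M -> Q (upd_var s x (den s a)) ->
  tr (CAssign x a) 1 s Q.
Proof.
move=> b sm le q; exists 1, (upd_var s x (den s a)); split=> //.
  by apply: EAssign; apply: aeval_den.
by case: b => bv bm; split=> //= y; case: ifP.
Qed.

Lemma tr_store arr ai av s (Q : state -> Prop) :
  bounded M s -> small_aexp ai -> small_aexp av -> den s av <= M ->
  Q (upd_mem s arr (den s ai) (den s av)) -> tr (CStore arr ai av) 1 s Q.
Proof.
move=> b smi smv le q; exists 1, (upd_mem s arr (den s ai) (den s av)); split=> //.
  by apply: EStore; apply: aeval_den.
by case: b => bv bm; split=> //= a i; case: ifP.
Qed.

Lemma tr_le c k k' s (Q : state -> Prop) : tr c k' s Q -> k' <= k -> tr c k s Q.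
Proof. by move=> h le; apply: tr_conseq h le _. Qed.

Lemma tr_seq c1 c2 k1 k2 s (Q1 Q : state -> Prop) :
  tr c1 k1 s Q1 ->
  (forall s', bounded M s' -> frame c1 s s' -> Q1 s' -> tr c2 k2 s' Q) ->
  tr (CSeq c1 c2) (k1 + k2) s Q.
Proof.
move=> [k [s1 [ex1 le1 b1 q1]]] /(_ s1 b1 (exec_frame ex1) q1).
move=> [k' [s2 [ex2 le2 b2 q2]]]; exists (k + k'), s2; split=> //.
  exact: ESeq ex1 ex2.
by lia.
Qed.

Lemma tr_assign_seq x a c k s (Q : state -> Prop) :
  bounded M s -> small_aexp a -> den s a <= M ->
  (bounded M (upd_var s x (den s a)) -> tr c k (upd_var s x (den s a)) Q) ->
  tr (CSeq (CAssign x a) c) k.+1 s Q.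
Proof.
move=> b sm le h; rewrite -add1n; apply: (tr_seq (Q1 := eq (upd_var s x (den s a)))).
  exact: tr_assign.
by move=> s' b' _ Es; rewrite -Es in b' *; apply: h.
Qed.

Lemma tr_store_seq arr ai av c k s (Q : state -> Prop) :
  bounded M s -> small_aexp ai -> small_aexp av -> den s av <= M ->
  (bounded M (upd_mem s arr (den s ai) (den s av)) ->
     tr c k (upd_mem s arr (den s ai) (den s av)) Q) ->
  tr (CSeq (CStore arr ai av) c) k.+1 s Q.
Proof.
move=> b smi smv le h; rewrite -add1n.
apply: (tr_seq (Q1 := eq (upd_mem s arr (den s ai) (den s av)))).
  exact: tr_store.
by move=> s' b' _ Es; rewrite -Es in b' *; apply: h.
Qed.

Lemma tr_if b c1 c2 k s (Q : state -> Prop) :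
  bounded M s -> small_aexp b ->
  (den s b != 0 -> tr c1 k s Q) -> (den s b = 0 -> tr c2 k s Q) ->
  tr (CIf b c1 c2) k.+1 s Q.
Proof.
move=> bs sm h1 h2; have ev := aeval_den bs sm.
case: (eqVneq (den s b) 0) => [z | nz].
  have [k' [s' [ex le b' q]]] := h2 z; exists k'.+1, s'; split=> //.
  by apply: EIfF => //; rewrite ev z.
have [k' [s' [ex le b' q]]] := h1 nz; exists k'.+1, s'; split=> //.
exact: EIfT ev nz ex.
Qed.

(** Each iteration also pays for the test and the increment; the final 2 is the initialization and
    the failing test. The invariant is insensitive to the loop variable, whose value is supplied
    separately, and the frame recovers facts about everything the loop does not write. *)
Lemma tr_for x b body N k s (I : nat -> state -> Prop) :
  bounded M s -> N <= M -> x \notin mvars body -> small_aexp (ALt (AVar x) b) ->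
  (forall s', frame (CFor x b body) s s' -> den s' b = N) ->
  (forall i s' v, I i s' -> I i (upd_var s' x v)) ->
  I 0 s ->
  (forall i s', i < N -> bounded M s' -> frame (CFor x b body) s s' ->
     vars s' x = i -> I i s' -> tr body k s' (I i.+1)) ->
  tr (CFor x b body) (N * (k + 2) + 2) s (I N).
Proof.
move=> bs NM xb sm bE Ix I0 step.
rewrite addnC addSn add1n -[X in tr _ X]add1n.
apply: (tr_seq (Q1 := fun s' => I 0 s' /\ vars s' x = 0)).
  apply: tr_assign => //=; split; first exact: Ix.
  by rewrite eqxx.
move=> s' b' fr' [I0' x0].
have {}fr' : frame (CFor x b body) s s'.
  by apply: frame_sub fr' => y //=; rewrite !inE => ->.
have [d Ed] : exists d, N = 0 + d by exists N.
have -> : (N * (k + 2)).+1 = (d * (k + 2)).+1 by rewrite {1}Ed.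
have {x0 I0'} : I 0 s' /\ vars s' x = 0 by [].
elim: d {1 2 3}0 Ed s' b' fr' => [|d IHd] i Ed s' b' fr' [Ii xi].
  have iN : i = N by lia.
  exists 1, s'; split=> //; last by rewrite -iN.
  by apply: EWhileF; rewrite aeval_den //= (bE _ fr') xi iN ltnn.
have lt : i < N by lia.
have [k1 [s1 [ex1 le1 b1 q1]]] := step i s' lt b' fr' xi Ii.
have fr1 := exec_frame ex1.
have x1 : vars s1 x = i by rewrite (fr1.1 _ xb).
have fr1' : frame (CFor x b body) s s1.
  apply: frame_trans fr' (frame_sub _ _ fr1) => y yb /=.
    by rewrite inE mem_cat yb orbT.
  by rewrite mem_cat yb.
pose s2 := upd_var s1 x i.+1.
have ex2 : exec W (CAssign x (AAdd (AVar x) (ANum 1))) s1 1 s2.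
  rewrite /s2; apply: EAssign; rewrite aeval_den //= x1 addn1 //.
have b2 : bounded M s2.
  by case: b1 => bv bm; split=> //= y; case: ifP => // _; lia.
have fr2 : frame (CFor x b body) s s2.
  apply: frame_trans fr1' (frame_sub _ _ (exec_frame ex2)) => y //=.
  by rewrite !inE => ->.
have Ed' : N = i.+1 + d by lia.
have H2 : I i.+1 s2 /\ vars s2 x = i.+1 by split; [apply: Ix | rewrite /= eqxx].
have [k3 [s3 [ex3 le3 b3 q3]]] := IHd i.+1 Ed' s2 b2 fr2 H2.
exists ((k1 + 1) + k3).+1, s3; split=> //; last lia.
apply: (EWhileT (v := 1)) (ESeq ex1 ex2) ex3 => //.
by rewrite aeval_den //= (bE _ fr') xi lt.
Qed.

(** * Correctness of the program *)

Section LeafSearch.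

Variables (n : nat) (e : rel 'I_n).
Hypothesis M_big : n + 2 <= M.

Definition leaf_data (own : 'I_n -> nat) (v p : nat) : Prop :=
  exists w : 'I_n, [/\ v = w, own w = w,
    forall u : 'I_n, own u = u -> e w u -> u = p :> nat &
    p = n \/ exists u : 'I_n, [/\ p = u, own u = u & e w u]].

Let nbrs (own : 'I_n -> nat) (x : 'I_n) (i : nat) : {set 'I_n} :=
  [set u : 'I_n | (u < i) && ((own u == u) && e x u)].

Lemma leaf_spec s (own : 'I_n -> nat) : bounded M s -> vars s 0 = n ->
  (forall u : 'I_n, Defs.mem s 3 u = (own u != u)) ->
  (forall u v : 'I_n, Defs.mem s 0 (u * n + v) = e u v) ->
  (exists x : 'I_n, own x = x /\ #|[set u | (own u == u) && e x u]| <= 1) ->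
  tr leaf_prog (n * (5 * n + 10) + 2) s
    (fun s' => leaf_data own (vars s' 3) (vars s' 4)).
Proof.
move=> bs n0 dead adj [x0 [ox0 leaf0]].
(* Conditional, because variables 3 and 4 hold leftovers until a leaf has been seen; later leaves
   simply overwrite earlier ones. *)
pose I i (s' : state) :=
  (exists x : 'I_n, [/\ x < i, own x = x & #|nbrs own x n| <= 1]) ->
  leaf_data own (vars s' 3) (vars s' 4).
have nbrsE x : nbrs own x n = [set u | (own u == u) && e x u].
  by apply/setP=> u; rewrite !inE ltn_ord.
have fE i : i < n -> exists x : 'I_n, i = x by move=> lt; exists (Ordinal lt).
have -> : 5 * n + 10 = (5 * n + 8) + 2 by lia.
apply: (tr_conseq (Q' := I n) (k' := n * (5 * n + 8 + 2) + 2)) => //; last first.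
  by move=> s' _ _; apply; exists x0; rewrite nbrsE.
apply: (tr_for (I := I)) => //=.
- by lia.
- by move=> s' [fv _]; rewrite fv.
- by move=> [x []].
move=> i s1 /fE[x ->] {i} b1 [fv1 fm1] x5 I1.
have n1 : vars s1 0 = n by rewrite fv1.
have dead1 u : Defs.mem s1 3 u = Defs.mem s 3 u by rewrite fm1.
have adj1 u : Defs.mem s1 0 u = Defs.mem s 0 u by rewrite fm1.
rewrite addnS; apply: tr_if => //=; rewrite x5 dead1 dead; last first.
  move=> ox; apply: (tr_conseq (tr_skip (Q := eq s1) _ _)) => //; first by lia.
  move=> s2 _ _ <- [y [yx oy ny]]; apply: I1; exists y; split=> //.
  move: yx; rewrite ltnS leq_eqVlt => /orP[/eqP yx|//].
  by move: ox; rewrite -(val_inj yx) oy eqxx.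
case: (eqVneq (own x) x) => // ox _.
apply: (tr_le (k' := (5 * n + 2 + 3).+2)); last by lia.
apply: tr_assign_seq => //= b2; apply: tr_assign_seq => //=; first by rewrite n1; lia.
rewrite n1; move=> b3; set s3 := upd_var _ _ _ in b3 *.
(* Variable 8 is meaningful only while the count is below 2: it is then the unique neighbor found,
   or [n]. *)
pose J j (s' : state) := vars s' 7 = #|nbrs own x j| /\
  (vars s' 7 < 2 -> (vars s' 8 = n /\ nbrs own x j = set0) \/
     exists u, nbrs own x j = [set u] /\ vars s' 8 = u).
apply: (tr_seq (Q1 := J n)).
  have -> : 5 * n + 2 = n * (3 + 2) + 2 by lia.
  apply: (tr_for (I := J)) => //=.
  - by lia.
  - by move=> s' [fv _]; rewrite fv.
  - have z : nbrs own x 0 = set0 by apply/setP=> u; rewrite !inE.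
    by split=> /=; [rewrite z cards0 | move=> _; left].
  move=> j s4 jn b4 [fv4 fm4] y6 [J1 J2].
  have x4 : vars s4 5 = x by rewrite fv4.
  have n4 : vars s4 0 = n by rewrite fv4.
  have dead4 u : Defs.mem s4 3 u = Defs.mem s 3 u by rewrite fm4 //= dead1.
  have adj4 u : Defs.mem s4 0 u = Defs.mem s 0 u by rewrite fm4 //= adj1.
  have step : #|nbrs own x j.+1| = #|nbrs own x j| + ((own (Ordinal jn) == j) && e x (Ordinal jn)).
    by rewrite /nbrs (card_ltnS (fun u => (own u == u) && e x u) jn).
  have cnt : #|nbrs own x j| <= j.
    rewrite -[X in _ <= X](size_iota 0 j) cardE -(size_map val); apply: uniq_leq_size.
      by rewrite (map_inj_uniq val_inj) enum_uniq.
    by move=> z /mapP[w]; rewrite mem_enum inE => /andP[wj _] ->; rewrite mem_iota.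
  have deadj : Defs.mem s 3 j = (own (Ordinal jn) != j) := dead (Ordinal jn).
  have adjj : Defs.mem s 0 (x * n + j) = e x (Ordinal jn) := adj x (Ordinal jn).
  apply: tr_if => //=; rewrite y6 x4 n4 dead4 adj4 deadj adjj.
    case: (eqVneq (own (Ordinal jn)) j) step => //= oj step.
    case ej : (e x (Ordinal jn)) step => // step _.
    apply: (tr_le (k' := 2)) => //; apply: tr_assign_seq => //=; first by rewrite J1; lia.
    move=> b5; apply: tr_assign => //=; first by rewrite y6; lia.
    split=> /=; first by rewrite J1 step.
    rewrite J1 => c2; have c0 : #|nbrs own x j| = 0 by lia.
    right; exists (Ordinal jn); split; last by rewrite y6.
    apply/eqP; rewrite eq_sym eqEcard cards1 step c0 leqnn andbT.
    by rewrite sub1set inE /= ltnSn ej oj eqxx.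
  move=> nadj; apply: (tr_conseq (tr_skip (Q := eq s4) _ _)) => // s5 _ _ <-.
  have no : ((own (Ordinal jn) == j) && e x (Ordinal jn)) = false.
    by move: nadj; case: (own (Ordinal jn) == j); case: (e x (Ordinal jn)).
  suff E : nbrs own x j.+1 = nbrs own x j by rewrite /J E.
  apply/eqP; rewrite eq_sym eqEcard step no addn0 leqnn andbT.
  by apply/subsetP=> u; rewrite !inE => /andP[uj ->]; rewrite ltnS ltnW.
move=> s5 b5 [fv5 fm5] [J1 J2].
have x5' : vars s5 5 = x by rewrite fv5.
have v35 : vars s5 3 = vars s1 3 by rewrite fv5.
have v45 : vars s5 4 = vars s1 4 by rewrite fv5.
have n8 : vars s5 8 <= M by case: b5.
apply: tr_if => //=; last first.
  move=> c2; apply: (tr_conseq (tr_skip (Q := eq s5) _ _)) => // s6 _ _ <-.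
  move=> [y [yx oy ny]]; rewrite v35 v45; apply: I1; exists y; split=> //.
  move: yx; rewrite ltnS leq_eqVlt => /orP[/eqP yx|//].
  by move: c2; rewrite J1 -(val_inj yx) ltnS ny.
case: (ltnP (vars s5 7) 2) => // /J2 cs _.
apply: tr_assign_seq => //=; first by rewrite x5'; have := ltn_ord x; lia.
move=> b6; apply: tr_assign => //= _ /=; exists x; split=> //.
  move=> u ou exu; have un : u \in nbrs own x n by rewrite inE ltn_ord ou eqxx.
  case: cs => [[_ z]|[w [z ->]]]; first by rewrite z inE in un.
  by move: un; rewrite z inE => /eqP ->.
case: cs => [[-> _]|[w [z ->]]]; [by left | right; exists w].
have : w \in nbrs own x n by rewrite z inE.
by rewrite inE => /andP[_ /andP[/eqP ? ?]].
Qed.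

End LeafSearch.

(** * The loop that merges two tables *)

Section Merging.

Variables n t : nat.
Hypotheses (tn : t <= n) (M_big : 100 * ((n + 2) * (n + 2)) <= M).

Definition table (s : state) (id st j : nat) : nat := Defs.mem s 4 (adT n id st j).
Definition labels (s : state) (id st j u : nat) : nat := Defs.mem s 5 (adL n id st j u).

(** Ensures that the merge loop misses no combination. *)
Lemma decode_exists m s1 s2 j1 j2 : m < 2 -> s1 < 6 -> s2 < 6 -> j1 <= t -> j2 <= t ->
  exists2 k, k < 72 * ((t + 1) * (t + 1)) &
    [/\ k %% 2 = m, (k %/ 2) %% 6 = s1, (k %/ 12) %% 6 = s2,
        (k %/ 72) %% (t + 1) = j1 & (k %/ 72) %/ (t + 1) = j2].
Proof.
move=> m2 s16 s26 j1t j2t; set X := j2 * (t + 1) + j1.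
have Xlt : X < (t + 1) * (t + 1) by rewrite /X; nia.
have Xm : X %% (t + 1) = j1 by rewrite modnMDl modn_small //; lia.
have Xd : X %/ (t + 1) = j2 by rewrite divnMDl ?divn_small ?addn0 //; lia.
have E72 : (72 * X + 12 * s2 + 2 * s1 + m) %/ 72 = X by clearbody X; lia.
exists (72 * X + 12 * s2 + 2 * s1 + m); first by clearbody X; lia.
by rewrite E72; split=> //; clearbody X; lia.
Qed.

Lemma join_label_le m j1 j la lb : m < 2 ->
  join_label m j1 j la lb <= la + j.+2 + (lb + j1).
Proof.
move=> m2; rewrite /join_label leq_add //; last by case: (1 < lb); rewrite ?mul1n.
rewrite leq_add2l; case: (lb == 1) => //; rewrite mul1n.
by case: m m2 => [|[]] //= _; rewrite ?subn0 ?mul1n ?subnn ?mul0n; lia.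
Qed.

Lemma joinable_lt s1 s2 m : m < 2 -> s1 < 6 -> (m == 1) ==> joinable s1 s2 -> s1 + m * s2 < 6.
Proof.
case: m => [|[]] //= _ s16; first by rewrite addn0.
by rewrite mul1n => /joinable_state/andP[].
Qed.

Section Spec.

Variables (s : state) (p v r : nat).
Let idp := Defs.mem s 6 p.
Let idv := Defs.mem s 6 v.
Let new := n + 1 + r.

Definition merged (s' : state) : Prop :=
  [/\ (forall id st j, id != new -> st < 6 -> j <= t -> table s' id st j = table s id st j),
      (forall id st j u, id != new -> st < 6 -> j <= t -> u < n ->
         labels s' id st j u = labels s id st j u) &
      (forall st j w, st < 6 -> j <= t -> table s' new st j = w.+1 ->
         exists m s1 s2 j1 j2, combination t (table s) idp idv m s1 s2 j1 j2 /\
         [/\ st = s1 + m * s2, j = j1 + j2 + (1 - m) * (0 < s2),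
             w.+1 = table s idp s1 j1 + table s idv s2 j2 + m - 1
           & forall u, u < n -> labels s' new st j u =
               join_label m j1 j (labels s idp s1 j1 u) (labels s idv s2 j2 u)])].

Definition dominates (s' : state) m s1 s2 j1 j2 : Prop :=
  combination t (table s) idp idv m s1 s2 j1 j2 ->
  j1 + j2 + (1 - m) * (0 < s2) <= t ->
  table s idp s1 j1 + table s idv s2 j2 + m - 1 <= n ->
  table s idp s1 j1 + table s idv s2 j2 + m - 1
    <= table s' new (s1 + m * s2) (j1 + j2 + (1 - m) * (0 < s2)).

Definition done_upto (k : nat) (s' : state) : Prop :=
  forall i, i < k -> dominates s' (i %% 2) ((i %/ 2) %% 6) ((i %/ 12) %% 6)
    ((i %/ 72) %% (t + 1)) ((i %/ 72) %/ (t + 1)).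

Hypotheses (bs : bounded M s) (rn : r < n).
Hypotheses (s0 : vars s 0 = n) (s1 : vars s 1 = t) (s2 : vars s 2 = r)
  (s3 : vars s 3 = v) (s4 : vars s 4 = p).
Hypotheses (idp_new : idp != new) (idv_new : idv != new).
Hypothesis fresh : forall st j, st < 6 -> j <= t -> table s new st j = 0.
Hypothesis labp : forall st j u, st < 6 -> j <= t -> u < n -> 0 < table s idp st j ->
  labels s idp st j u <= n.+1.
Hypothesis labv : forall st j u, st < 6 -> j <= t -> u < n -> 0 < table s idv st j ->
  labels s idv st j u <= n.+1.

Let M100 : 100 * (n + 2) <= M. Proof. by move: M_big; nia. Qed.

Section Step.

Variables (i : nat) (S : state).
Hypotheses (i_lt : i < 72 * ((t + 1) * (t + 1))) (bS : bounded M S)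
  (fS : frame merge_prog s S) (iS : vars S 9 = i) (mS : merged S) (dS : done_upto i S).

Let m := i %% 2.
Let a1 := (i %/ 2) %% 6.
Let a2 := (i %/ 12) %% 6.
Let j1 := (i %/ 72) %% (t + 1).
Let j2 := (i %/ 72) %/ (t + 1).
Let a := a1 + m * a2.
Let j := j1 + j2 + (1 - m) * (0 < a2).
Let x := table s idp a1 j1.
Let y := table s idv a2 j2.

Let m2 : m < 2. Proof. by rewrite /m; lia. Qed.
Let a16 : a1 < 6. Proof. by rewrite /a1; lia. Qed.
Let a26 : a2 < 6. Proof. by rewrite /a2; lia. Qed.
Let j1t : j1 <= t. Proof. by rewrite -ltnS -[t.+1]addn1 ltn_pmod // addn1. Qed.
Let j2t : j2 <= t.
Proof.
rewrite -ltnS -[t.+1]addn1 /j2 ltn_divLR; last by rewrite addn1.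
by move: i_lt; move: ((t + 1) * (t + 1)) => z; lia.
Qed.
Let decoded (S' : state) : Prop :=
  [/\ vars S' 10 = m, vars S' 11 = a1, vars S' 12 = a2, vars S' 13 = j1 & vars S' 14 = j2] /\
  [/\ vars S' 15 = x, vars S' 16 = y, vars S' 17 = a & vars S' 18 = j].

Let decode_spec : tr decode_prog 9 S decoded.
Proof.
have [fv fm] := fS; have S0 : vars S 0 = n by rewrite fv.
have S1 : vars S 1 = t by rewrite fv.
have S3 : vars S 3 = v by rewrite fv.
have S4 : vars S 4 = p by rewrite fv.
have S6 q : Defs.mem S 6 q = Defs.mem s 6 q by rewrite fm.
have [tS _ _] := mS.
have [bv bm] := bS.
have xM : x <= M by case: bs => _; apply.
have yM : y <= M by case: bs => _; apply.
apply: tr_assign_seq => //=; rewrite iS -/m; first by lia.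
move=> b1; apply: tr_assign_seq => //=; rewrite iS -/a1; first by lia.
move=> b2; apply: tr_assign_seq => //=; rewrite iS -/a2; first by lia.
move=> b3; apply: tr_assign_seq => //=; rewrite iS S1 -/j1; first by lia.
move=> b4; apply: tr_assign_seq => //=; rewrite iS S1 -/j2; first by lia.
move=> b5; apply: tr_assign_seq => //=.
rewrite S0 S4 S6 -/idp -/(adT n idp a1 j1) -/(table S idp a1 j1) tS // -/x.
move=> b6; apply: tr_assign_seq => //=.
rewrite S0 S3 S6 -/idv -/(adT n idv a2 j2) -/(table S idv a2 j2) tS // -/y.
move=> b7; apply: tr_assign_seq => //=; first by nia.
rewrite -/a => b8; apply: tr_assign => //=.
by rewrite -/j; lia.
Qed.

Let combE : combination t (table s) idp idv m a1 a2 j1 j2 <->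
  [&& 0 < x, 0 < y & (m == 1) ==> joinable a1 a2].
Proof.
split; first by case=> _ [? ? ?]; apply/and3P.
by case/and3P.
Qed.

(** An entry is overwritten only by a strictly larger value, so earlier domination persists; its
    labeling is rewritten along with it, which preserves [merged]. *)
Lemma step_spec : tr merge_body (3 * n + 20) S
  (fun S' => merged S' /\ done_upto i.+1 S').
Proof.
apply: (tr_le (k' := 9 + (n * (1 + 2) + 3).+1)); last by lia.
apply: (tr_seq decode_spec) => S1 b1 f1 [[v10 v11 v12 v13 v14] [v15 v16 v17 v18]].
have [fv fm] := fS; have [fv1 fm1] := f1; have [tS lS upS] := mS.
have n0 : vars S1 0 = n by rewrite fv1 // fv.
have t1 : vars S1 1 = t by rewrite fv1 // fv.
have r2 : vars S1 2 = r by rewrite fv1 // fv.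
have v3 : vars S1 3 = v by rewrite fv1 // fv.
have p4 : vars S1 4 = p by rewrite fv1 // fv.
have S6 q : Defs.mem S1 6 q = Defs.mem s 6 q by rewrite fm1 // fm.
have S45 b q : Defs.mem S1 b q = Defs.mem S b q by rewrite fm1.
pose w := x + y + m - 1.
have wE s' : vars s' 15 = x -> vars s' 16 = y -> vars s' 10 = m -> den s' new_value = w.
  by rewrite /= => -> -> ->.
have newE s' : vars s' 0 = n -> vars s' 2 = r -> den s' new_id = new.
  by rewrite /= => -> ->.
have impE : (den S1 improves != 0) =
  [&& 0 < x, 0 < y, j <= t, w <= n, (m == 1) ==> joinable a1 a2 & table S new a j < w].
  rewrite /improves; cbn [den]; rewrite den_aT wE // newE // n0 t1.
  cbn [den]; rewrite v10 v11 v12 v15 v16 v17 v18 S45 -/(table S _ _ _) !addn1 !ltnS.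
  rewrite !muln_eq0 !negb_or !eqb0 !negbK -!andbA; congr [&& _, _, _, _ & _].
  rewrite addn_eq0 negb_and !muln_eq0 !negb_or !eqb0 !negbK; congr (_ && _).
  by rewrite /joinable; move: m2; case: (m) => [|[|]] //=; rewrite -!andbA.
apply: tr_if => //; rewrite ?impE; last first.
  move=> z; apply: (tr_conseq (tr_skip (Q := eq S1) _ _)) => //; first by lia.
  have tabE id st jj : table S1 id st jj = table S id st jj by apply: S45.
  have labE id st jj u : labels S1 id st jj u = labels S id st jj u by apply: S45.
  move=> _ _ _ <-; split.
    split=> [id st jj h1 h2 h3|id st jj u h1 h2 h3 h4|st jj w' h1 h2].
    - by rewrite tabE tS.
    - by rewrite labE lS.
    rewrite tabE => /upS -/(_ h1 h2)[m' [c1 [c2 [k1 [k2 [C [E1 E2 E3 E4]]]]]]].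
    by exists m', c1, c2, k1, k2; do 2!split=> //; move=> u un; rewrite labE E4.
  move=> k; rewrite ltnS leq_eqVlt => /orP[/eqP ->|ki]; last first.
    by move=> C h1 h2; rewrite tabE; apply: dS.
  move=> /combE/and3P[x0 y0 jm] jt wn; rewrite tabE -/w.
  have : ~~ (den S1 improves != 0) by rewrite z.
  by rewrite impE x0 y0 jt wn jm /= -leqNgt.
case/and5P=> x0 y0 jt wn /andP[jm tw].
have a6 : a < 6 by apply: joinable_lt.
have C : combination t (table s) idp idv m a1 a2 j1 j2 by apply/combE/and3P.
rewrite addn3; apply: tr_store_seq => //.
  by rewrite wE //; lia.
rewrite wE // den_aT newE //; cbn [den]; rewrite n0 v17 v18; set S2 := upd_mem _ _ _ _ => b2.
have tab2 id st jj : st < 6 -> jj <= t ->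
    table S2 id st jj = if [&& id == new, st == a & jj == j] then w else table S id st jj.
  move=> h1 h2; rewrite /table /S2 /= eq_adT // ?S45 //; lia.
pose J u (S' : state) := forall id st jj z, st < 6 -> jj <= t -> z < n ->
  labels S' id st jj z = if [&& id == new, st == a, jj == j & z < u]
    then join_label m j1 j (labels s idp a1 j1 z) (labels s idv a2 j2 z)
    else labels S id st jj z.
apply: (tr_conseq (Q' := J n) (k' := n * (1 + 2) + 2)) => //.
  apply: (tr_for (I := J)) => //=.
  - by move: M100; lia.
  - by move=> s' [gv _]; rewrite gv.
  - by move=> id st jj z h1 h2 h3; rewrite ltn0 !andbF /labels /S2 /= S45.
  move=> u S3 un b3 [gv gm] u5 J3.
  have n0' : vars S3 0 = n by rewrite gv.
  have r2' : vars S3 2 = r by rewrite gv.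
  have S6' q : Defs.mem S3 6 q = Defs.mem s 6 q by rewrite gm //= S6.
  (* The labels read belong to indices other than [new], so the cells already copied do not
     interfere. *)
  have lp : labels S3 idp a1 j1 u = labels s idp a1 j1 u by rewrite J3 // (negbTE idp_new) lS.
  have lv : labels S3 idv a2 j2 u = labels s idv a2 j2 u by rewrite J3 // (negbTE idv_new) lS.
  have valE : den S3 (5@(aL 6@(V 4) (V 11) (V 13) (V 5))
        + (5@(aL 6@(V 3) (V 12) (V 14) (V 5)) == K 1)
            * (V 10 + (K 1 - V 10) * (V 18 + K 1))
        + (K 1 < 5@(aL 6@(V 3) (V 12) (V 14) (V 5)))
            * (5@(aL 6@(V 3) (V 12) (V 14) (V 5)) + V 13))%A
      = join_label m j1 j (labels s idp a1 j1 u) (labels s idv a2 j2 u).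
    cbn [den]; rewrite !den_aL; cbn [den].
    rewrite n0' u5 !gv //= v3 p4 v10 v11 v12 v13 v14 v18 !S6' -/idp -/idv.
    by rewrite -!/(labels S3 _ _ _ _) lp lv addn1.
  apply: tr_store => //.
    rewrite valE; apply: leq_trans (join_label_le _ _ _ _ m2) _.
    have := labp a16 j1t un x0; have := labv a26 j2t un y0.
    by move: M100; lia.
  rewrite valE den_aL newE //; cbn [den]; rewrite n0' u5 !gv //= v17 v18.
  move=> id st jj z h1 h2 h3; rewrite /labels /= eq_adL //; try lia.
  rewrite ltnS [z <= u]leq_eqVlt.
  have := J3 id st jj z h1 h2 h3; rewrite /labels.
  case: (eqVneq id new) => //= _; case: (eqVneq st a) => //= _.
  by case: (eqVneq jj j) => //= _; case: (eqVneq z u) => [->|] //=.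
  by rewrite addn2.
move=> S' b' [gv gm] J'.
have tab' id st jj : table S' id st jj = table S2 id st jj by rewrite /table gm.
split.
  split=> [id st jj h1 h2 h3|id st jj u h1 h2 h3 h4|st jj w' h1 h2].
  - by rewrite tab' tab2 // (negbTE h1) tS.
  - by rewrite J' // (negbTE h1) lS.
  rewrite tab' tab2 // eqxx /=; case: ifP => [/andP[/eqP -> /eqP ->] Ew | ne].
    exists m, a1, a2, j1, j2; split=> //; split=> // u un.
    by rewrite J' // !eqxx un.
  move=> /upS -/(_ h1 h2)[m' [c1 [c2 [k1 [k2 [C' [E1 E2 E3 E4]]]]]]].
  exists m', c1, c2, k1, k2; do 2!split=> //; move=> u un.
  by rewrite J' // eqxx /= andbA ne /= E4.
have mono st jj : st < 6 -> jj <= t -> table S new st jj <= table S' new st jj.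
  move=> h1 h2; rewrite tab' tab2 // eqxx /=; case: ifP => // /andP[/eqP -> /eqP ->].
  exact: ltnW.
move=> k; rewrite ltnS leq_eqVlt => /orP[/eqP ->|ki].
  by move=> _ _ _; rewrite -/w tab' tab2 // !eqxx.
move=> C' h1 h2; apply: leq_trans (dS ki C' h1 h2) (mono _ _ _ h1).
by case: C' => -[? ? ? ? ?] [? ? ?]; apply: joinable_lt.
Qed.

End Step.

Lemma merge_spec : tr merge_prog (72 * ((t + 1) * (t + 1)) * (3 * n + 22) + 2) s
  (fun s' => merged s' /\ forall m a1 a2 j1 j2, dominates s' m a1 a2 j1 j2).
Proof.
have -> : 3 * n + 22 = (3 * n + 20) + 2 by lia.
pose I i s' := merged s' /\ done_upto i s'.
set N := 72 * _.
apply: (tr_conseq (Q' := I N) (k' := N * (3 * n + 20 + 2) + 2)) => //.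
  apply: (tr_for (I := I)) => //.
  - by have := M_big; have := tn; rewrite /N; nia.
  - by move=> s' [gv _]; cbn [den]; rewrite gv //= s1.
  - split=> //; split=> // st j w h1 h2; by rewrite fresh.
  by move=> i S iN bS fS iS [mS dS]; apply: step_spec.
move=> s' _ _ [ms ds]; split=> // m a1 a2 j1 j2 C.
have [[m2 a16 a26 j1t j2t] _] := C.
have [k kN [Em E1 E2 E3 E4]] := decode_exists m2 a16 a26 j1t j2t.
by have := ds k kN; rewrite Em E1 E2 E3 E4; apply.
Qed.

End Spec.
End Merging.

(** * Initialization and the elimination rounds *)

Section Rounds.

Variables (n t : nat) (e : rel 'I_n) (col : 'I_n -> bool).
Hypotheses (simple_e : simple_graph e) (forest_e : forest e).
Hypotheses (tn : t <= n) (M_big : 100 * ((n + 2) * (n + 2)) <= M).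

Let M100 : 100 * (n + 2) <= M. Proof. by move: M_big; nia. Qed.

Notation table := (table n).
Notation labels := (labels n).

(** [own] exists only in the proof; memory records just which vertices are removed and where live
    tables lie. Indices from [n + 1 + r] on are still zero, that is infeasible, as the next merge
    requires of its target. *)
Definition round_inv (r : nat) (s : state) : Prop :=
  exists own : 'I_n -> nat,
  [/\ #|[set u | own u == u]| = n - r,
      forall u : 'I_n, Defs.mem s 3 u = (own u != u),
      forall p, live own p -> Defs.mem s 6 p < n + 1 + r,
      forall id st j, n + 1 + r <= id -> st < 6 -> j <= t -> table s id st j = 0 &
      dp_inv e col t own (fun p => table s (Defs.mem s 6 p))
        (fun p st j u => labels s (Defs.mem s 6 p) st j u)].

Section Init.

Variable s : state.
Hypotheses (bs : bounded M s) (s0 : vars s 0 = n) (nt : n %/ 3 = t).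
Hypothesis colE : forall u : 'I_n, Defs.mem s 1 u = col u.
Hypothesis clear : forall a i, 2 <= a -> Defs.mem s a i = 0.

Let cs (id : nat) : nat := 3 - 2 * Defs.mem s 1 id.

Let filled (i : nat) (S : state) : Prop :=
  [/\ forall id st j, st < 6 -> j <= t ->
        table S id st j = [&& id < i, j == 0 & (st == 0) || (st == cs id)],
      forall id st j u, st < 6 -> j <= t -> u < n ->
        labels S id st j u = [&& id < i, j == 0, st == cs id & u == id] &
      forall a, a < i -> Defs.mem S 6 a = a].

Let cs6 id : cs id < 6. Proof. by rewrite /cs; lia. Qed.

Lemma init_spec : tr init_prog (n * 6 + (t + 1) * 3 + 6) s
  (fun s' => round_inv 0 s' /\ vars s' 1 = t).
Proof.
have [bv bm] := bs.
apply: (tr_le (k' := (n * (4 + 2) + 2 + ((t + 1) * (1 + 2) + 2).+1).+1)); last by lia.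
apply: tr_assign_seq => //=; first by rewrite s0 nt; lia.
rewrite s0 nt => b1; set S1 := upd_var _ _ _ in b1 *.
apply: (tr_seq (Q1 := filled n)).
  apply: (tr_for (I := filled)) => //=.
  - by lia.
  - by move=> S' [gv _]; rewrite gv.
  - split=> [id st j h1 h2|id st j u h1 h2 h3|//].
      by rewrite /table /= clear.
    by rewrite /labels /= clear.
  move=> i S iN bS [gv gm] iS [FT FL FI].
  have S0 : vars S 0 = n by rewrite gv.
  have S1E q : Defs.mem S 1 q = Defs.mem s 1 q by rewrite gm.
  apply: tr_store_seq => //=; first by lia.
  rewrite iS => b2; apply: tr_store_seq => //=; first by lia.
  rewrite iS S0 => b3; apply: tr_store_seq => //=; first by lia.
  rewrite iS S0 S1E -/(cs i) => b4; apply: tr_store => //=; first by lia.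
  rewrite iS S0 S1E -/(cs i).
  have csi := cs6 i.
  split=> [id st j h1 h2|id st j u h1 h2 h3|a].
  - have := FT id st j h1 h2; rewrite /table /= -/(adT n i 0 0) -/(adT n i (cs i) 0).
    rewrite !eq_adT //; try lia.
    rewrite ltnS [id <= i]leq_eqVlt.
    have [->|] := eqVneq id i; last by [].
    have [->|] := eqVneq j 0; last by rewrite ltnn !andbF.
    rewrite ltnn !andbT /=; case: (eqVneq st (cs i)) => [->|] /=; first by rewrite orbT.
    by case: (eqVneq st 0).
  - have := FL id st j u h1 h2 h3; rewrite /labels /= -/(adT n i (cs i) 0) -/(adL n i (cs i) 0 i).
    rewrite !eq_adL //; try lia.
    rewrite ltnS [id <= i]leq_eqVlt.
    have [->|] := eqVneq id i; last by [].
    have [->|] := eqVneq j 0; last by rewrite ltnn !andbF.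
    rewrite ltnn /=; case: (eqVneq st (cs i)) => [->|] //=.
    by case: (eqVneq u i).
  rewrite ltnS leq_eqVlt /=; case: (eqVneq a i) => [->|] //= _; exact: FI.
move=> S2 b2 [gv gm] [FT FL FI].
have S20 : vars S2 0 = n by rewrite gv.
have S21 : vars S2 1 = t by rewrite gv.
apply: tr_store_seq => //=; first by rewrite S20; lia.
rewrite S20 => b3; set S3 := upd_mem _ _ _ _ in b3 *.
pose J y (S : state) := forall id st j, st < 6 -> j <= t ->
  table S id st j = if id == n then (st == 0) && (j < y) : nat else table S2 id st j.
apply: (tr_conseq (Q' := J (t + 1)) (k' := (t + 1) * (1 + 2) + 2)) => //.
  apply: (tr_for (I := J)) => //=.
  - by lia.
  - by move=> S' [hv _]; rewrite hv //= S21.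
  - move=> id st j h1 h2; rewrite ltn0 andbF /table /=.
    by case: eqP => // ->; rewrite -/(table S2 n st j) FT // ltnn.
  move=> y S yt b4 [hv hm] y6 J4.
  have S40 : vars S 0 = n by rewrite hv.
  apply: tr_store => //=; first by lia.
  rewrite S40 y6 => id st j h1 h2; have := J4 id st j h1 h2.
  rewrite /table /= -/(adT n n 0 y) eq_adT //; try lia.
  rewrite ltnS [j <= y]leq_eqVlt.
  case: (eqVneq id n) => //= _; case: (eqVneq st 0) => //= _.
  by case: (eqVneq j y).
move=> S' b' [hv hm] J'; split; last by rewrite hv //= S21.
have E3 q : Defs.mem S' 3 q = 0 by rewrite hm //= gm //= clear.
have E6 q : q <= n -> Defs.mem S' 6 q = q.
  rewrite hm //= leq_eqVlt; case: (eqVneq q n) => [-> //|] _ /= qn; exact: FI.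
have E6' p : live (@nat_of_ord n) p -> Defs.mem S' 6 p = p.
  by case=> [->|[v -> _]]; rewrite E6 // ltnW.
have labE id st j u : labels S' id st j u = labels S2 id st j u by rewrite /labels hm.
exists (@nat_of_ord n); split.
- by rewrite subn0 -[RHS]card_ord -cardsT; apply: eq_card => u; rewrite !inE eqxx.
- by move=> u; rewrite E3 eqxx.
- by move=> p lp; rewrite E6' //; case: lp => [->|[v -> _]]; [lia | have := ltn_ord v; lia].
- move=> id st j idn h1 h2; rewrite J' // FT //.
  by case: eqP => [|_]; [lia | rewrite ltnNge (leq_trans _ idn) //; lia].
apply: (dp_inv_init simple_e.2).
- move=> v st j h1 h2; rewrite E6 1?ltnW // J' // FT // ltn_ord /cs colE.
  by case: eqP => // h; have := ltn_ord v; rewrite h ltnn.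
- by move=> st j h1 h2; rewrite E6 // J' // eqxx addn1 ltnS h2 andbT.
- move=> v st u h1; rewrite E6 1?ltnW // labE FL // ltn_ord /cs colE -/(color_state (col v)) /=.
  by case: eqP => [->|_]; rewrite ?andbF //; case: (col v).
by move=> j u jt; rewrite E6 // labE FL // ltnn.
Qed.

End Init.

Section Round.

Variables (i : nat) (S : state).
Hypotheses (iN : i < n) (bS : bounded M S) (iS : vars S 2 = i).
Hypotheses (S0 : vars S 0 = n) (S1 : vars S 1 = t).
Hypothesis adj : forall u v : 'I_n, Defs.mem S 0 (u * n + v) = e u v.
Hypothesis invS : round_inv i S.

Lemma round_spec :
  tr (leaf_prog ;; merge_prog ;; CStore 3 (V 3) (K 1) ;; CStore 6 (V 4) new_id)%C
    (n * (5 * n + 10) + 72 * ((t + 1) * (t + 1)) * (3 * n + 22) + 6) S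
    (round_inv i.+1).
Proof.
have [own [alive dead ids fresh inv]] := invS.
set k1 := n * (5 * n + 10) + 2; set k2 := 72 * ((t + 1) * (t + 1)) * (3 * n + 22) + 2.
apply: (tr_le (k' := k1 + (k2 + 2))); last by rewrite /k1 /k2; lia.
apply: (tr_seq (Q1 := fun s' => leaf_data e own (vars s' 3) (vars s' 4))).
  apply: leaf_spec => //; first by lia.
  (* Since [i < n], some vertex remains, and the forest on the remaining vertices has a leaf. *)
  have ne : [set u | own u == u] != set0 by rewrite -card_gt0 alive subn_gt0.
  have [x] := forest_leaf simple_e forest_e ne; rewrite inE => /eqP ox leaf.
  exists x; split=> //; apply: leq_trans leaf; apply: subset_leq_card.
  by apply/subsetP=> u; rewrite !inE.
move=> s b [fv fm] [v [v3 ov nbr_v pP]].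
have {fm} fm a q : Defs.mem s a q = Defs.mem S a q by apply: fm.
set p := vars s 4 in nbr_v pP *.
have live_p : live own p.
  by case: pP => [->|[u [-> ou _]]]; [left | right; exists u].
have live_v : live own v by right; exists v.
have pv : p != v :> nat.
  case: pP => [->|[u [-> ou evu]]]; first by have := ltn_ord v; lia.
  by apply/eqP=> /val_inj uv; rewrite uv simple_e.1 in evu.
have edge_vp (u : 'I_n) : u = p :> nat -> e v u.
  case: pP => [->|[u' [-> ou evu]] /val_inj -> //].
  by have := ltn_ord u => /[swap] ->; rewrite ltnn.
have s0 : vars s 0 = n by rewrite fv.
have s1 : vars s 1 = t by rewrite fv.
have s2 : vars s 2 = i by rewrite fv.
have tabE id st j : table s id st j = table S id st j by apply: fm.
have labE id st j u : labels s id st j u = labels S id st j u by apply: fm.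
have labels_le q st j u : live own q -> st < 6 -> j <= t -> u < n ->
    0 < table s (Defs.mem s 6 q) st j -> labels s (Defs.mem s 6 q) st j u <= n.+1.
  move=> lq h1 h2 un; rewrite tabE labE fm => h3.
  have := sound_label (inv_sound inv lq h1 h2 (esym (prednK h3))) (Ordinal un).
  by rewrite /=; lia.
have idp := ids p live_p; have idv := ids v live_v.
apply: (tr_seq (merge_spec (p := p) (v := v) (r := i) tn M_big b iN s0 s1 s2 v3 erefl _ _ _ _ _)).
- by rewrite fm ltn_eqF.
- by rewrite fm ltn_eqF.
- by move=> st j h1 h2; rewrite tabE fresh.
- by move=> st j u h1 h2 h3; apply: labels_le.
- by move=> st j u h1 h2 h3; apply: labels_le.
move=> s' b' [fv' fm'] [[tS lS upper] lower].
have v3' : vars s' 3 = v by rewrite fv'.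
have p4' : vars s' 4 = p by rewrite fv'.
have i2' : vars s' 2 = i by rewrite fv'.
have n0' : vars s' 0 = n by rewrite fv'.
apply: tr_store_seq => //=; first by lia.
move=> b3; apply: tr_store => //=; first by rewrite n0' i2'; lia.
rewrite v3' p4' n0' i2'.
pose own' (u : 'I_n) := if own u == v then p else own u.
set new := n + 1 + i in tS lS upper lower fresh ids idp idv *.
set S' := upd_mem _ _ _ _.
have own'E u : (own' u == u) = (own u == u) && (u != v) by apply: own_merge_fixed.
have live'P q : live own' q -> live own q /\ q != v :> nat.
  case=> [->|[u -> /eqP]]; first by split; [left | have := ltn_ord v; lia].
  by rewrite own'E => /andP[/eqP ou uv]; split=> //; right; exists u.
have id' q : live own q -> Defs.mem S' 6 q = if q == p then new else Defs.mem S 6 q.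
  by move=> lq; rewrite /S' /=; case: eqP => // _; rewrite fm' //= fm.
exists own'; split.
- have -> : n - i.+1 = (n - i).-1 by lia.
  rewrite -alive [in RHS](cardsD1 v) inE ov eqxx /=; apply: eq_card => u.
  by rewrite inE own'E !inE andbC.
- move=> u; rewrite /= own'E fm' //= fm dead val_eqE.
  by case: (eqVneq u v) => [->|]; rewrite ?andbF ?andbT.
- move=> q lq; have [lq' _] := live'P q lq.
  by rewrite id' //; case: ifP => _; [rewrite /new; lia | have := ids q lq'; lia].
- move=> id st j idn h1 h2; rewrite -[LHS]/(table s' id st j) tS //; last by rewrite /new; lia.
  by rewrite tabE fresh // /new; lia.
pose T := fun q => table s (Defs.mem s 6 q).
pose L := fun q st j (u : 'I_n) => labels s (Defs.mem s 6 q) st j u.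
have inv0 : dp_inv e col t own T L.
  apply: dp_inv_ext inv => [q st j lq h1 h2|q st j u lq h1 h2].
    by rewrite /T tabE fm.
  by rewrite /L labE fm.
have := dp_inv_merge simple_e forest_e inv0 live_p ov pv nbr_v edge_vp
  (T' := table s' new) (L' := fun st j u => labels s' new st j u).
move=> H; apply: dp_inv_ext (H _ _) => [q st j lq h1 h2|q st j u lq h1 h2||].
- have [lq' _] := live'P q lq; rewrite id' // -[LHS]/(table s' _ st j).
  case: ifP => // _; rewrite tS //; first by rewrite /T fm.
  by rewrite ltn_eqF // ids.
- have [lq' _] := live'P q lq; rewrite id' // -[LHS]/(labels s' _ st j u).
  case: ifP => // _; rewrite lS //; first by rewrite /L fm.
  by rewrite ltn_eqF // ids.
- move=> st j w h1 h2 /upper -/(_ h1 h2)[m [a1 [a2 [j1 [j2 [C [E1 E2 E3 E4]]]]]]].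
  exists m, a1, a2, j1, j2; do 2!split=> //; move=> u; exact: E4.
by move=> m a1 a2 j1 j2 C h1 h2; apply: lower.
Qed.

End Round.

Lemma rounds_spec s : bounded M s -> vars s 0 = n -> vars s 1 = t ->
  (forall u v : 'I_n, Defs.mem s 0 (u * n + v) = e u v) -> round_inv 0 s ->
  tr rounds_prog
    (n * (n * (5 * n + 10) + 72 * ((t + 1) * (t + 1)) * (3 * n + 22) + 8) + 2) s
    (round_inv n).
Proof.
move=> b s0 s1 adj inv0; set Kb := n * (5 * n + 10) + _ + 8.
have -> : Kb = n * (5 * n + 10) + 72 * ((t + 1) * (t + 1)) * (3 * n + 22) + 6 + 2.
  by rewrite /Kb; lia.
apply: (tr_for (I := round_inv)) => //.
- by lia.
- by move=> s' [fv _]; rewrite /= fv.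
move=> i S iN bS [fv fm] iS invS; apply: round_spec => //.
- by rewrite fv.
- by rewrite fv.
by move=> u v; rewrite fm.
Qed.

End Rounds.

(** * Greedy completion of the optimal labeling *)

Section Filling.

Variables (n t : nat) (e : rel 'I_n) (col : 'I_n -> bool).
Hypotheses (simple_e : simple_graph e) (forest_e : forest e).
Hypotheses (t0 : 0 < t) (tn : t <= n) (M_big : 100 * ((n + 2) * (n + 2)) <= M).
Hypothesis color_card : forall b, #|color_class col b| = t * b.+1.

Let M100 : 100 * (n + 2) <= M. Proof. by move: M_big; nia. Qed.

(** If all [t] classes are full in the color of [u], they use up every vertex of this color, leaving
    none unlabeled. *)
Lemma full_color_labelled (L : 'I_n -> nat) u :
  (forall w, L w = 0 \/ 1 < L w <= t.+1) ->
  (forall l, l < t -> (col u).+1 <= ncol col L (col u) l.+2) -> L u != 0.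
Proof.
move=> lab full; apply/eqP=> Lu.
pose A := [set w in color_class col (col u) | 1 < L w].
have A_lt : #|A| < t * (col u).+1.
  rewrite -color_card; apply: proper_card; apply/properP; split.
    by apply/subsetP=> w; rewrite inE => /andP[].
  by exists u; rewrite !inE ?eqxx // Lu andbF.
have : t * (col u).+1 <= \sum_(l < t) ncol col L (col u) l.+2.
  rewrite -[X in X * _](card_ord t) -sum_nat_const; apply: leq_sum => l _; exact: full.
rewrite leqNgt => /negP; apply; apply: leq_trans A_lt; rewrite ltnS.
case: t t0 lab => // t' _ lab.
rewrite (card_by_label A (fun w => inord (L w - 2) : 'I_t'.+1)).
apply: leq_sum => l _; apply/subset_leq_card/subsetP=> w; rewrite !inE.
case/andP=> -> /eqP Lw; rewrite Lw /= subn2 /=.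
by apply/eqP/val_inj; rewrite /= inordK.
Qed.

Variables (L0 : 'I_n -> nat).

Definition out (s : state) (u : 'I_n) : nat := Defs.mem s 2 u.

Definition fill_inv (s : state) : Prop :=
  [/\ forall u, out s u = 0 \/ 1 < out s u <= t.+1,
      forall l b, 1 < l -> ncol col (out s) b l <= b.+1 &
      intra e L0 \subset intra e (out s)].

(** Only an unlabeled vertex receives a label, so no edge inside a class is lost. *)
Lemma fill_inv_store s s' u l : fill_inv s -> out s u = 0 -> l < t ->
  ncol col (out s) (col u) l.+2 < (col u).+1 ->
  (forall w, out s' w = if w == u then l.+2 else out s w) -> fill_inv s'.
Proof.
move=> [lab cap sub] u0 lt room E; split.
- by move=> w; rewrite E; case: eqP => // _; right; lia.
- move=> l' b l1; have [/andP[/eqP -> /eqP ->] | ne] := boolP ((l' == l.+2) && (b == col u)).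
    apply: leq_trans room; rewrite /ncol [X in X <= _](cardsD1 u) -[X in _ <= X]add1n leq_add ?leq_b1 //.
    apply/subset_leq_card/subsetP=> w; rewrite !inE E.
    by case: (w == u).
  apply: leq_trans (cap l' b l1); apply/subset_leq_card/subsetP=> w; rewrite !inE E.
  case: (eqVneq w u) => // -> /andP[/eqP cb /eqP lb].
  by rewrite -cb -lb !eqxx in ne.
apply: subset_trans sub _; apply/subsetP=> -[x y]; rewrite !inE /= !E.
case/and4P=> -> -> /eqP xy x0 /=.
have /negPf -> : x != u by apply: contraNneq x0 => ->; rewrite u0.
have /negPf -> : y != u by apply: contraNneq x0 => yu; rewrite xy yu u0.
by rewrite xy eqxx -xy.
Qed.

Section Vertex.

Variables (u : 'I_n) (S : state).
Hypotheses (bS : bounded M S) (S0 : vars S 0 = n) (S1 : vars S 1 = t) (uS : vars S 5 = u).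
Hypothesis colE : forall w : 'I_n, Defs.mem S 1 w = col w.
Hypotheses (fS : fill_inv S) (doneS : forall w : 'I_n, w < u -> out S w != 0).

Lemma fill_vertex_spec : tr
  (CFor 6 (V 1) (
    7 <- K 0 ;;
    CFor 9 (V 0) (
      CIf ((2@(V 9) == V 6 + K 2) * (1@(V 9) == 1@(V 5))) (7 <- V 7 + K 1) CSkip) ;;
    CIf ((V 7 < K 1 + 1@(V 5)) * (2@(V 5) == K 0)) (CStore 2 (V 5) (V 6 + K 2)) CSkip))%C
  (t * (4 * n + 7) + 2) S
  (fun s' => fill_inv s' /\ forall w : 'I_n, w < u.+1 -> out s' w != 0).
Proof.
(* If [u] is still unlabeled after [y] classes were offered, these are full in its color; at [y = t]
   this is impossible by counting. *)
pose G y (s : state) := [/\ fill_inv s, forall w : 'I_n, w < u -> out s w != 0 &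
  out s u = 0 -> forall l, l < y -> (col u).+1 <= ncol col (out s) (col u) l.+2].
have -> : 4 * n + 7 = 4 * n + 5 + 2 by lia.
apply: (tr_conseq (Q' := G t) (k' := t * (4 * n + 5 + 2) + 2)) => //; last first.
  move=> s' _ _ [f' d' full]; split=> // w; rewrite ltnS leq_eqVlt => /orP[/eqP wu|]; last exact: d'.
  have {w wu} -> : w = u by apply: val_inj.
  apply/negP=> /eqP ou; have := full_color_labelled (L := out s') (u := u).
  by case: f' => lab _ _ /(_ lab (full ou)); rewrite ou.
apply: (tr_for (I := G)) => //=.
- by lia.
- by move=> s' [fv _]; rewrite fv.
move=> y s yt b [fv fm] y6 [f d full].
have s0 : vars s 0 = n by rewrite fv.
have s5 : vars s 5 = u by rewrite fv.
have cE (w : 'I_n) : Defs.mem s 1 w = col w by rewrite fm.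
apply: (tr_le (k' := (n * (2 + 2) + 2 + 2).+1)); last by lia.
apply: tr_assign_seq => //= b1; set s1 := upd_var _ _ _ in b1 *.
pose P (w : 'I_n) := (out s w == y.+2) && (col w == col u).
pose J x (s' : state) := vars s' 7 = #|[set w : 'I_n | (w < x) && P w]|.
apply: (tr_seq (Q1 := J n)).
  apply: (tr_for (I := J)) => //=.
  - by lia.
  - by move=> s' [gv _]; rewrite gv.
  - by symmetry; apply/eqP; rewrite cards_eq0; apply/eqP/setP=> w; rewrite !inE.
  move=> x s2 xn b2 [gv gm] x9 J2.
  have s25 : vars s2 5 = u by rewrite gv.
  have y26 : vars s2 6 = y by rewrite gv.
  have c2 (w : 'I_n) : Defs.mem s2 1 w = col w by rewrite gm //= cE.
  have step := card_ltnS P xn.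
  have le : #|[set w : 'I_n | (w < x) && P w]| <= n by rewrite -[X in _ <= X]card_ord max_card.
  have condE : den s2 ((2@(V 9) == V 6 + K 2) * (1@(V 9) == 1@(V 5)))%A = P (Ordinal xn).
    rewrite /= x9 s25 y26 c2 (c2 (Ordinal xn)) gm //= addn2 /P /out /=.
    by case: (_ == _) => //=; case: (col _); case: (col _).
  apply: tr_if => //; rewrite condE => c.
    apply: tr_assign => //=; first by rewrite J2; lia.
    by rewrite /J /= J2 step; case: (P _) c.
  apply: (tr_conseq (tr_skip (Q := eq s2) _ _)) => // s3 _ _ <-.
  by rewrite /J J2 step c addn0.
move=> s2 b2 [gv gm] J2.
have s20 : vars s2 0 = n by rewrite gv.
have s25 : vars s2 5 = u by rewrite gv.
have y26 : vars s2 6 = y by rewrite gv //= y6.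
have cu : Defs.mem s2 1 u = col u by rewrite gm //= cE.
have outE w : out s2 w = out s w by rewrite /out gm.
have cnt : vars s2 7 = ncol col (out s) (col u) y.+2.
  by rewrite J2; apply: eq_card => w; rewrite !inE ltn_ord /= /P andbC.
have condE : den s2 ((V 7 < K 1 + 1@(V 5)) * (2@(V 5) == K 0))%A =
    (ncol col (out s) (col u) y.+2 < (col u).+1) && (out s u == 0).
  rewrite /= s25 cnt cu -/(out s2 u) outE add1n.
  by case: (_ < _); case: (_ == _).
have ncolE b' l : ncol col (out s2) b' l = ncol col (out s) b' l.
  by apply: eq_card => w; rewrite !inE outE.
have f2 : fill_inv s2.
  case: f => lab cap sub; split=> [w|l b' l1|]; rewrite ?outE ?ncolE //; first exact: cap.
  by rewrite (eq_intra e outE).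
apply: tr_if => //; rewrite condE => c.
  have {c} /andP[room /eqP u0] : (ncol col (out s) (col u) y.+2 < (col u).+1) && (out s u == 0).
    by case: (_ && _) c.
  apply: tr_store => //=; first by rewrite y26; lia.
  rewrite s25 y26 addn2; set s3 := upd_mem _ _ _ _.
  have E3 w : out s3 w = if w == u then y.+2 else out s2 w by rewrite /out /= val_eqE.
  split.
  - by apply: fill_inv_store f2 _ yt _ E3; rewrite ?outE ?ncolE.
  - by move=> w wu; rewrite E3 outE; case: (w == u) => //; apply: d.
  by rewrite E3 eqxx.
apply: (tr_conseq (tr_skip (Q := eq s2) _ _)) => // s3 _ _ <-; split=> //.
  by move=> w wu; rewrite outE d.
rewrite outE => u0 l; rewrite ltnS leq_eqVlt => /orP[/eqP ->|ly]; rewrite ncolE; last exact: full.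
by move: c; rewrite u0 eqxx andbT; case: ltnP.
Qed.

End Vertex.

Section Start.

Variable s : state.
Hypotheses (bs : bounded M s) (s0 : vars s 0 = n) (s1 : vars s 1 = t).
Hypothesis colE : forall w : 'I_n, Defs.mem s 1 w = col w.
Hypothesis L0E : forall u : 'I_n, labels n s (Defs.mem s 6 n) 0 t u = L0 u.
Hypothesis lab0 : forall u, L0 u = 0 \/ 1 < L0 u <= t.+1.
Hypothesis cap0 : forall l b, 1 < l -> ncol col L0 b l <= b.+1.

Lemma fill_spec : tr fill_prog (n * 3 + n * (t * (4 * n + 7) + 4) + 4) s
  (fun s' => fill_inv s' /\ forall w, out s' w != 0).
Proof.
apply: (tr_le (k' := (n * (1 + 2) + 2) + (n * (t * (4 * n + 7) + 2 + 2) + 2))); last by lia.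
pose I i (s' : state) := forall u : 'I_n, u < i -> out s' u = L0 u.
apply: (tr_seq (Q1 := I n)).
  apply: (tr_for (I := I)) => //=.
  - by lia.
  - by move=> s' [fv _]; rewrite fv.
  move=> i S iN bS [fv fm] iS IS.
  have S0 : vars S 0 = n by rewrite fv.
  have S1 : vars S 1 = t by rewrite fv.
  have vE : den S (5@(aL 6@(V 0) (K 0) (V 1) (V 5)))%A = L0 (Ordinal iN).
    rewrite -L0E; cbn [den]; rewrite den_aL; cbn [den].
    by rewrite S0 S1 iS fm // fm.
  apply: tr_store => //.
    by rewrite vE; have := lab0 (Ordinal iN); lia.
  rewrite vE; cbn [den]; rewrite iS => u ui; rewrite /out /=.
  have [/eqP ui'|ne] := boolP (u == i :> nat).
    by congr L0; apply: val_inj.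
  by apply: IS; rewrite ltn_neqAle ne -ltnS.
move=> S1 b1 [fv fm] I1.
pose F i (s' : state) := fill_inv s' /\ forall w : 'I_n, w < i -> out s' w != 0.
have out1 w : out S1 w = L0 w by apply: I1.
apply: (tr_conseq (Q' := F n) (k' := n * (t * (4 * n + 7) + 2 + 2) + 2)) => //; last first.
  by move=> s' _ _ [f d]; split=> // w; apply: d.
apply: (tr_for (I := F)) => //=.
- by lia.
- by move=> s' [gv _]; rewrite gv //= fv.
- split=> //; split=> [w|l b l1|]; rewrite ?out1 //.
    apply: leq_trans (cap0 b l1); apply: ncol_le => w; by rewrite out1.
  by rewrite (eq_intra e out1).
move=> i S iN bS [gv gm] iS [f d].
apply: (fill_vertex_spec (u := Ordinal iN)) => //.
- by rewrite gv //= fv.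
- by rewrite gv //= fv.
by move=> w; rewrite gm //= fm.
Qed.

End Start.

End Filling.

(** After [n] rounds the dummy root owns every vertex. Its state 0 admits no label 1, so the labels
    in use are 2 to [t + 1], and by the budget property the entry at [j = t] covers every feasible
    labeling. *)
Lemma final_table n t (e : rel 'I_n) (col : 'I_n -> bool) s :
  simple_graph e -> round_inv t e col n s ->
  exists2 L0 : 'I_n -> nat, (forall u : 'I_n, labels n s (Defs.mem s 6 n) 0 t u = L0 u) &
  [/\ forall u, L0 u = 0 \/ 1 < L0 u <= t.+1,
      forall l b, 1 < l -> ncol col L0 b l <= b.+1 &
      forall q, feasible e col t q -> #|kept e q setT| <= #|intra e L0|].
Proof.
move=> simple_e [own [alive _ _ _ inv]]; exists (labels n s (Defs.mem s 6 n) 0 t) => //.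
have no_own (v : 'I_n) : own v <> v.
  move=> ov; have : 0 < #|[set u | own u == u]|.
    by apply/card_gt0P; exists v; rewrite inE ov eqxx.
  by rewrite alive subnn.
have own_n u : own u = n by case: (inv_own inv u) => [//|[v _ /no_own]].
have terr_n : terr own n = setT by apply/setP=> u; rewrite !inE own_n eqxx.
have root q : feasible e col t q -> #|kept e q setT| < table n s (Defs.mem s 6 n) 0 t.
  move=> fq; have := inv_root inv fq; rewrite terr_n; apply=> //.
  by case: fq.
(* Soundness speaks of positive entries only; the empty labeling shows that this one is positive. *)
have T0 : 0 < table n s (Defs.mem s 6 n) 0 t.
  have fq : feasible e col t (fun=> None).
    split=> [l b|].
      by rewrite /color_count (_ : [set _ in _ | _] = set0) ?cards0 //; apply/setP=> u; rewrite !inE.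
    rewrite (_ : kept_classes _ _ _ = set0) ?cards0 //; apply/setP=> l; rewrite in_set0.
    by apply/negP=> /kept_classesP[x [y [_ _ _ _ []]]].
  by apply: leq_ltn_trans (root _ fq).
have S := inv_sound inv (or_introl erefl) (ltn0Sn 5) (leqnn t) (esym (prednK T0)).
split.
- move=> u; have h1 := sound_label S u; have h2 := sound_open S (col u).
  have n1 : labels n s (Defs.mem s 6 n) 0 t u <> 1.
    move=> h; have : 0 < ncol col (fun w : 'I_n => labels n s (Defs.mem s 6 n) 0 t w) (col u) 1.
      by apply/card_gt0P; exists u; rewrite inE h !eqxx.
    by rewrite ltnNge (leq_trans h2) //; case: (col u).
  by move: h1 n1; case: (labels _ _ _ _ _ _) => [|[|k]]; [left | | right].
- exact: sound_closed S.
by move=> q fq; apply: leq_trans (sound_val S); rewrite -ltnS prednK //; apply: root.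
Qed.

Lemma clustering_spec n t (e : rel 'I_n) (col : 'I_n -> bool) :
  simple_graph e -> forest e -> 0 < t -> n = 3 * t ->
  (forall b, #|color_class col b| = t * b.+1) ->
  100 * ((n + 2) * (n + 2)) <= M ->
  tr clustering_prog
    (n * 6 + (t + 1) * 3 + 6
     + (n * (n * (5 * n + 10) + 72 * ((t + 1) * (t + 1)) * (3 * n + 22) + 8) + 2
        + (n * 3 + n * (t * (4 * n + 7) + 4) + 4)))
    (init_state e col)
    (fun s' => min_cost_fair_clustering e col (@output_labeling n s')).
Proof.
move=> simple_e forest_e t0 n3t cc M_big.
have tn : t <= n by lia.
have M1 : 1 <= M by lia.
have b0 : bounded M (init_state e col).
  split=> [x|a i] /=; first by case: ifP => _ //; nia.
  by do 2?case: ifP => _ //; apply: leq_trans (leq_b1 _) _.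
have adj0 (u v : 'I_n) : Defs.mem (init_state e col) 0 (u * n + v) = e u v.
  rewrite /=; congr nat_of_bool; apply/existsP/idP => [[x /existsP[y]]|euv].
    by rewrite eq_muladd // !val_eqE => /andP[/andP[/eqP -> /eqP ->]].
  by exists u; apply/existsP; exists v; rewrite eqxx.
have col0 (u : 'I_n) : Defs.mem (init_state e col) 1 u = col u.
  rewrite /=; congr nat_of_bool; apply/existsP/idP => [[x]|cu].
    by rewrite val_eqE => /andP[/eqP ->].
  by exists u; rewrite eqxx.
have clear a i : 2 <= a -> Defs.mem (init_state e col) a i = 0.
  by case: a => [|[]].
have nt : n %/ 3 = t by rewrite n3t mulKn.
apply: tr_seq (init_spec simple_e tn M_big b0 _ nt col0 clear) _ => // s1 b1 [fv1 fm1] [inv1 t1].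
apply: tr_seq.
  apply: (rounds_spec simple_e forest_e tn M_big b1 _ t1 _ inv1); first by rewrite fv1.
  by move=> u v; rewrite fm1.
move=> s2 b2 [fv2 fm2] /(final_table simple_e)[L0 L0E [lab0 cap0 opt0]].
have s20 : vars s2 0 = n by rewrite fv2 // fv1.
have s21 : vars s2 1 = t by rewrite fv2 // t1.
have col2 (w : 'I_n) : Defs.mem s2 1 w = col w by rewrite fm2 // fm1.
apply: (tr_conseq (fill_spec e t0 tn M_big cc b2 s20 s21 col2 L0E lab0 cap0)) => //.
move=> s' _ _ [[lab cap sub] nz].
apply: (full_labels_min simple_e forest_e t0 n3t cc) => //.
  by move=> u; case: (lab u) (nz u) => [->|].
by move=> q fq; apply: leq_trans (opt0 q fq) (subset_leq_card sub).
Qed.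

End Programs.

(** For [3 <= n] the factor 100 is below (n+2)^3, so the base is at most (n+2)^5. Sixty factors give
    exponent 300, and strictness needs one more. *)
Lemma word_bound n d : 3 <= n -> d <= 60 ->
  (100 * ((n + 2) * (n + 2))) ^ d < (n + 2) ^ 301.
Proof.
move=> n3 d60.
have le5 : 100 * ((n + 2) * (n + 2)) <= (n + 2) ^ 5.
  have -> : (n + 2) ^ 5 = (n + 2) ^ 3 * ((n + 2) * (n + 2)) by rewrite mulnn -expnD.
  rewrite leq_mul2r; apply/orP; right; apply: (@leq_trans (5 ^ 3)) => //.
  by rewrite leq_exp2r //; lia.
apply: (@leq_ltn_trans ((n + 2) ^ (5 * d))).
  by rewrite expnM; case: (d) => // d'; rewrite leq_exp2r.
by rewrite ltn_exp2l; lia.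
Qed.

(** The dominant term has [n] rounds, a quadratic number of combinations in each, and a labeling of
    length [n] copied per combination: fourth order, which is then relaxed to the sixth power. *)
Lemma time_bound n t : 0 < n -> t <= n ->
  n * 6 + (t + 1) * 3 + 6
  + (n * (n * (5 * n + 10) + 72 * ((t + 1) * (t + 1)) * (3 * n + 22) + 8) + 2
     + (n * 3 + n * (t * (4 * n + 7) + 4) + 4)) <= 100 * 100 * n ^ 6.
Proof.
move=> n0 tn.
have t2 : t + 1 <= 2 * n by lia.
have tt : (t + 1) * (t + 1) <= 4 * (n * n).
  by apply: leq_trans (leq_mul t2 t2) _; lia.
have n46 : n ^ 4 <= n ^ 6 by rewrite leq_pexp2l.
apply: leq_trans (leq_mul (leqnn (100 * 100)) n46).
have -> : n ^ 4 = n * (n * (n * n)) by rewrite !expnS expn0 muln1.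
have a2 : n <= n * n by nia.
have a3 : n * n <= n * (n * n) by nia.
have a4 : n * (n * n) <= n * (n * (n * n)) by nia.
have b1 : 72 * ((t + 1) * (t + 1)) * (3 * n + 22) <= 72 * 100 * (n * (n * n)).
  apply: (@leq_trans (72 * (4 * (n * n)) * (25 * n))); last by nia.
  by apply: leq_mul; [rewrite leq_mul2l tt orbT | lia].
have b2 : t * (4 * n + 7) <= n * (11 * n) by apply: leq_mul; lia.
have c1 : n * (5 * n + 10) <= 15 * (n * n) by nia.
have d1 : n * (n * (5 * n + 10) + 72 * ((t + 1) * (t + 1)) * (3 * n + 22) + 8)
    <= n * ((72 * 101) * (n * (n * n))) by rewrite leq_mul2l; apply/orP; right; lia.
have d2 : n * (t * (4 * n + 7) + 4) <= n * (15 * (n * n)).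
  by rewrite leq_mul2l; apply/orP; right; lia.
lia.
Qed.

Theorem mainTheorem12 :
  exists (P : cmd) (C k : nat),
    forall (n : nat) (e : rel 'I_n) (col : 'I_n -> bool),
      simple_graph e -> forest e -> ratio_1_2 col ->
      exists (steps : nat) (s' : state),
        [/\ exec ((n + 2) ^ k) P (init_state e col) steps s',
            steps <= C * n ^ 6
          & min_cost_fair_clustering e col (@output_labeling n s')].
Proof.
exists clustering_prog, (100 * 100), 301 => n e col simple_e forest_e [t t0 [c1 c2]].
have cc b : #|color_class col b| = t * b.+1.
  by case: b; rewrite ?c1 ?c2 ?muln1 // mulnC.
have n3t : n = 3 * t.
  rewrite -[LHS](card_ord n) -cardsT (card_by_label _ col) big_bool /=.
  have E b : #|[set x in [set: 'I_n] | col x == b]| = t * b.+1.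
    by rewrite -cc; apply: eq_card => u; rewrite !inE.
  by rewrite !E; lia.
have n3 : 3 <= n by lia.
(* Quadratic because the merge counter is itself a stored value and reaches
   [72 * ((t + 1) * (t + 1))]. *)
pose M := 100 * ((n + 2) * (n + 2)).
have M100 : 100 <= M by rewrite /M; nia.
have MW d : d <= 60 -> M ^ d < (n + 2) ^ 301 by apply: word_bound.
have [steps [s' [ex le _ opt]]] :=
  clustering_spec M100 MW simple_e forest_e t0 n3t cc (leqnn M).
exists steps, s'; split=> //; apply: leq_trans le (time_bound _ _); lia.
Qed.
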